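(* In the braided symmetric algebra $\mathcal{A}_m$, the $\mathrm{U}_q$-invariants $\Phi^{(i,j)}$ ($i\le j$) satisfy the following relations, for indices in $\{1,\dots,m\}$ (a symbol $\Phi^{(a,b)}$ with $a>b$ is understood as in the context, i.e. $\Phi^{(a,b)}=q^{-12}\Phi^{(b,a)}$): $$\Phi^{(i,i)}\Phi^{(j,k)}-\Phi^{(j,k)}\Phi^{(i,i)}=0,\quad\text{for all } i,j,k;$$ $$\Phi^{(i,k)}\Phi^{(i,j)}-q^2\Phi^{(i,j)}\Phi^{(i,k)}=\frac{1-q^{14}}{\dim_q(V)}\Phi^{(i,i)}\Phi^{(j,k)},\quad k\neq i,j;\ i<j;$$ $$\Phi^{(i,j)}\Phi^{(j,k)}-q^2\Phi^{(j,k)}\Phi^{(i,j)}=\frac{1-q^{14}}{\dim_q(V)}\Phi^{(j,j)}\Phi^{(i,k)},\quad k\neq i,j;\ i<j;$$ $$\Phi^{(i,j)}\Phi^{(k,l)}-\Phi^{(k,l)}\Phi^{(i,j)}=0,\quad\text{if } i\le j,\ k\le l\text{ and either } j<k,\text{ or }k<i<j<l,\text{ or }l<i;$$ $$q^{-1}\Phi^{(k,l)}\Phi^{(i,j)}-q\Phi^{(i,j)}\Phi^{(k,l)}=(q-q^{-1})\left[\Phi^{(i,l)}\Phi^{(k,j)}-(q^2+q^{-2})\Phi^{(i,k)}\Phi^{(j,l)}+\Upsilon^{(i,k,j,l)}\right],\quad i<k<j<l.$$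
   Context: $\mathrm{U}_q=\mathrm{U}_q(G_2)$ is the quantum group over $\mathbb{C}(q)$ ($q$ an indeterminate) with generators $E_i,F_i,K_i^{\pm1}$, $i=1,2$, and the standard Drinfeld–Jimbo relations, for simple roots $\alpha_1$ (short), $\alpha_2$ with $(\alpha_1,\alpha_1)=2$, $(\alpha_1,\alpha_2)=-3$, $(\alpha_2,\alpha_2)=6$. Co-multiplication: $\Delta(E_i)=E_i\otimes K_i+1\otimes E_i$, $\Delta(F_i)=F_i\otimes 1+K_i^{-1}\otimes F_i$, $\Delta(K_i)=K_i\otimes K_i$. $V_\lambda$ is the type-$\mathbf 1$ simple module with highest weight $\lambda$; $\lambda_1=2\alpha_1+\alpha_2$, $\lambda_2=3\alpha_1+2\alpha_2$. $V=V_{\lambda_1}$ is the 7-dimensional simple module with basis $v_1,v_2,v_3,v_0,v_{-3},v_{-2},v_{-1}$ and action (basis vectors not listed are sent to $0$): $E_1: v_2\mapsto v_1,\ v_0\mapsto (q+q^{-1})v_3,\ v_{-3}\mapsto -(q+q^{-1})v_0,\ v_{-1}\mapsto -v_{-2}$; $E_2: v_3\mapsto v_2,\ v_{-2}\mapsto -v_{-3}$; $F_1: v_1\mapsto v_2,\ v_3\mapsto v_0,\ v_0\mapsto -v_{-3},\ v_{-2}\mapsto -v_{-1}$; $F_2: v_2\mapsto v_3,\ v_{-3}\mapsto -v_{-2}$; $K_1$, $K_2$ act diagonally (in the order $v_1,v_2,v_3,v_0,v_{-3},v_{-2},v_{-1}$) with eigenvalues $(q,q^{-1},q^2,1,q^{-2},q,q^{-1})$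 and $(1,q^3,q^{-3},1,q^3,q^{-3},1)$. $\dim_qV=q^{10}+q^8+q^2+1+q^{-2}+q^{-8}+q^{-10}$. $V\otimes V=V_{2\lambda_1}\oplus V_{\lambda_2}\oplus V_{\lambda_1}\oplus V_0$; $\wedge_q^2V=V_{\lambda_2}\oplus V_{\lambda_1}$; $S_q(V)=T(V)/\langle\wedge_q^2V\rangle$, where $T(V)$ is the tensor algebra; $X_a$ is the image of $v_a$ in $S_q(V)$. Braiding: with universal $R$-matrix $\sum_t\alpha_t\otimes\beta_t$, set $\check R_{W,W'}(w\otimes w')=\sum_t\beta_tw'\otimes\alpha_tw$, with $\check R_{V,V}=q^2P[2\lambda_1]+q^{-12}P[0]-P[\lambda_2]-q^{-6}P[\lambda_1]$, where $P[\mu]$ is the projection of $V\otimes V$ onto $V_\mu$. The braided tensor product of module algebras $A,B$ is $A\otimes B$ with multiplication $(\mu_A\otimes\mu_B)(\mathrm{id}_A\otimes\check R_{B,A}\otimes\mathrm{id}_B)$; $\mathcal{A}_m$ is $S_q(V)^{\otimes m}$ with the iterated braided multiplication. Put $X_{ia}=1^{\otimes(i-1)}\otimes X_a\otimes1^{\otimes(m-i)}$; thus $X_{ja}X_{ib}=\sum_t\beta_t(X_{ib})\alpha_t(X_{ja})$ for $i<j$. Let $\varphi_{1,-1}=q^4$, $\varphi_{-1,1}=q^{-6}$, $\varphi_{2,-2}=q^3$, $\varphi_{-2,2}=q^{-5}$, $\varphi_{3,-3}=1$, $\varphi_{-3,3}=q^{-2}$, $\varphi_{00}=1$, other $\varphi_{ab}=0$.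 Let $\gamma:V\to V\otimes V$ be the unique $\mathrm{U}_q$-map with $\gamma(v_1)=v_1\otimes v_0-q^{-6}v_0\otimes v_1-(q^{-3}+q^{-1})(v_2\otimes v_3-q^{-3}v_3\otimes v_2)$, and write $\gamma(v_a)=\sum_{r,s}\gamma_{ars}v_r\otimes v_s$. Define, for $i\le j$, $$\Phi^{(i,j)}=\sum_{a,b}\varphi_{ab}X_{ia}X_{jb};$$ for $i<j$, $\Phi^{(j,i)}$ is defined by exchanging $i$ and $j$ in this formula, and one has $\Phi^{(j,i)}=q^{-12}\Phi^{(i,j)}$. For $i<j<k<\ell$ define $$\Upsilon^{(i,j,k,\ell)}=\sum_{a,b,c,d}c_{abcd}X_{ia}X_{jb}X_{kc}X_{\ell d},\quad c_{abcd}=q^6\sum_{f,h}\varphi_{fh}\gamma_{fab}\gamma_{hcd}.$$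
   Formalization: In the second and third relations the condition k≠i,j is replaced by k<i or k>j: for i<k<j the printed relations are false, since together with the valid instances they would force, as q→1, (v_i·v_k)(v_i·v_j)=(v_i·v_i)(v_k·v_j) or its analogue. *)

(* Defs.v *)
From HB Require Import structures.
From mathcomp Require Import all_boot all_order all_algebra.
From mathcomp Require Import reals.
From mathcomp.real_closed Require Import complex.
From mathcomp.finmap Require Import finmap.
From mathcomp.multinomials Require Import monalg.

Set Implicit Arguments.
Unset Strict Implicit.
Unset Printing Implicit Defensive.

Import GRing.Theory Num.Theory.
Local Open Scope ring_scope.

Definition Cq (R : realType) : fieldType := {fraction {poly R[i]}}.

Definition qv {R : realType} : Cq R := tofrac 'X.

(* The basis v_1, v_2, v_3, v_0, v_{-3}, v_{-2}, v_{-1} of V, in this order. *)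
Definition p1 : 'I_7 := Ordinal (isT : 0 < 7)%N.
Definition p2 : 'I_7 := Ordinal (isT : 1 < 7)%N.
Definition p3 : 'I_7 := Ordinal (isT : 2 < 7)%N.
Definition z0 : 'I_7 := Ordinal (isT : 3 < 7)%N.
Definition m3 : 'I_7 := Ordinal (isT : 4 < 7)%N.
Definition m2 : 'I_7 := Ordinal (isT : 5 < 7)%N.
Definition m1 : 'I_7 := Ordinal (isT : 6 < 7)%N.

(* The simple roots alpha_1 (short) and alpha_2 are indexed by 0 and 1 : 'I_2,
   and root_form i j = (alpha_i, alpha_j). *)
Definition root_form (i j : 'I_2) : int :=
  if i != j then - 3%:Z else if i == ord0 then 2%:Z else 6%:Z.

(* The weight n1 alpha_1 + n2 alpha_2 is encoded by (n1, n2). *)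
Definition weight : Type := (int * int)%type.

Definition form_weight (i : 'I_2) (mu : weight) : int :=
  root_form i ord0 * mu.1 + root_form i ord_max * mu.2.

Definition lambda1 : weight := (2, 1).
Definition lambda2 : weight := (3, 2).

(* The generators E_i, F_i, K_i, K_i^-1 of U_q(G_2); the U_q-modules V and
   V (x) V below are given by the operators by which they act. *)
Variant Uqgen : Type :=
  | gE of 'I_2 | gF of 'I_2 | gK of 'I_2 | gKV of 'I_2.

Section QuantumG2.
Variable R : realType.

Local Notation K := (Cq R).
Local Notation q := (@qv R).

(* V consists of row vectors and operators act by right multiplication: the
   entry (a, b) of an operator is the coefficient of v_b in the image of v_a. *)
Local Notation V := 'rV[K]_7.

Definition bvec (a : 'I_7) : V := delta_mx 0 a.

Definition actE (i : 'I_2) : 'M[K]_7 :=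
  if i == ord0 then
    delta_mx p2 p1 + (q + q^-1) *: delta_mx z0 p3
    - (q + q^-1) *: delta_mx m3 z0 - delta_mx m1 m2
  else delta_mx p3 p2 - delta_mx m2 m3.

Definition actF (i : 'I_2) : 'M[K]_7 :=
  if i == ord0 then
    delta_mx p1 p2 + delta_mx p3 z0 - delta_mx z0 m3 - delta_mx m2 m1
  else delta_mx p2 p3 - delta_mx m3 m2.

Definition wtK (i : 'I_2) : seq int :=
  if i == ord0 then [:: 1; - 1; 2; 0; - 2; 1; - 1]
  else [:: 0; 3; - 3; 0; 3; - 3; 0].

Definition actK (i : 'I_2) : 'M[K]_7 := diag_mx (\row_a q ^ (wtK i)`_a).

Definition actV (g : Uqgen) : 'M[K]_7 :=
  match g with
  | gE i => actE i
  | gF i => actF i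
  | gK i => actK i
  | gKV i => invmx (actK i)
  end.

(* V (x) V consists of matrices: v_a (x) v_b is delta_mx a b. *)
Local Notation VV := 'M[K]_7.

Definition tens (u v : V) : VV := u^T *m v.

(* (A (x) B) (u (x) v) = (u *m A) (x) (v *m B) *)
Definition tensop (A B : 'M[K]_7) : 'End(VV) :=
  linfun (mulmxr B \o mulmx A^T).

(* The action on V (x) V through the co-multiplication. *)
Definition actVV (g : Uqgen) : 'End(VV) :=
  match g with
  | gE i => tensop (actE i) (actK i) + tensop 1%:M (actE i)
  | gF i => tensop (actF i) 1%:M + tensop (invmx (actK i)) (actF i)
  | gK i => tensop (actK i) (actK i)
  | gKV i => tensop (invmx (actK i)) (invmx (actK i))
  end.

Definition is_Uqmap (f : 'Hom(V, VV)) : Prop :=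
  forall (g : Uqgen) (v : V), f (v *m actV g) = actVV g (f v).

Definition submod_step (U : {vspace VV}) : {vspace VV} :=
  (U + \sum_(i < 2) (actVV (gE i) @: U + actVV (gF i) @: U
                     + actVV (gK i) @: U + actVV (gKV i) @: U))%VS.

(* The submodule generated by U; dim (V (x) V) steps are enough. *)
Definition submod_gen (U : {vspace VV}) : {vspace VV} :=
  iter (7 * 7) submod_step U.

Definition hw_space (mu : weight) : {vspace VV} :=
  (\bigcap_(i < 2) (lker (actVV (gE i))
     :&: passmx.leigenspace (actVV (gK i)) (q ^ form_weight i mu)))%VS.

(* V_mu, as the submodule generated by the highest weight vectors of weight mu
   (multiplicities are one). *)
Definition Vsub (mu : weight) : {vspace VV} := submod_gen (hw_space mu).

Definition VV_weights : seq weight :=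
  [:: (4, 2); lambda2; lambda1; (0, 0)].

(* P[mu], along the other constituents. *)
Definition Pproj (mu : weight) : 'End(VV) :=
  daddv_pi (Vsub mu) (\sum_(nu <- VV_weights | nu != mu) Vsub nu)%VS.

Definition Rcheck : 'End(VV) :=
  q ^+ 2 *: Pproj (4, 2) + q ^- 12 *: Pproj (0, 0)
  - Pproj lambda2 - q ^- 6 *: Pproj lambda1.

(* Rcheck (v_a (x) v_b) = \sum_(c, d) Rcoef a b c d v_c (x) v_d *)
Definition Rcoef (a b c d : 'I_7) : K := Rcheck (delta_mx a b) c d.

(* \wedge_q^2 V *)
Definition wedge2 : {vspace VV} := (Vsub lambda2 + Vsub lambda1)%VS.

(* Words in the basis of V; they form a basis of the tensor algebra. *)
Local Notation word := {fmonom 'I_7}.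

Local Notation TV := {malg K[word]}.

Definition TVdeg2 (r : VV) : TV :=
  \sum_(a < 7) \sum_(b < 7) r a b *: << mmul (fmu a) (fmu b) >>.

Definition in_span (U : lmodType K) (G : U -> Prop) (x : U) : Prop :=
  exists (n : nat) (c : 'I_n -> K) (g : 'I_n -> U),
    (forall i, G (g i)) /\ x = \sum_i c i *: g i.

(* The two-sided ideal <\wedge_q^2 V> of T(V); S_q(V) is the quotient. *)
Definition Sq_ideal : TV -> Prop :=
  in_span (fun x => exists (u v : TV) (r : VV),
    r \in wedge2 /\ x = u * TVdeg2 r * v).

(* Linear extension of a function given on a basis. *)
Definition mext (B : choiceType) (U : lmodType K) (f : B -> U)
    (x : {malg K[B]}) : U := \sum_(k <- msupp x) x@_k *: f k.

(* The braiding of V with the tensor powers of V, then of the tensor powers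
   among themselves: the hexagon identities
     R_{U, W (x) W'} = (id_W (x) R_{U, W'}) (R_{U, W} (x) id_{W'}),
     R_{U (x) U', W} = (R_{U, W} (x) id_{U'}) (id_U (x) R_{U', W})
   reduce it to Rcheck. The results lie in T(V) (x) V and T(V) (x) T(V). *)
Fixpoint braid1 (a : 'I_7) (u : seq 'I_7) : {malg K[(word * 'I_7)%type]} :=
  if u is b :: u' then
    \sum_(c < 7) \sum_(d < 7) Rcoef a b c d *:
      mext (fun p => << (mmul (fmu c) p.1, p.2) >>) (braid1 d u')
  else << (mone, a) >>.

Fixpoint braid (w : seq 'I_7) (u : word) : {malg K[(word * word)%type]} :=
  if w is a :: w' then
    mext (fun p : word * word =>
            mext (fun r => << (r.1, mmul (fmu r.2) p.2) >>) (braid1 a p.1))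
         (braid w' u)
  else << (u, mone) >>.

(* T(V)^{(x) m}; m-tuples of words are its pure tensors of basis elements. *)
Definition Tm (m : nat) : lmodType K := {malg K[m.-tuple word]}.

(* The braiding T(V)^{(x) m} (x) T(V) -> T(V) (x) T(V)^{(x) m}. *)
Fixpoint braid_tuple (m : nat) :
    m.-tuple word -> word -> {malg K[(word * m.-tuple word)%type]} :=
  match m with
  | 0 => fun _ u => << (u, [tuple]) >>
  | m'.+1 => fun x u =>
      mext (fun p : word * m'.-tuple word =>
              mext (fun r => << (r.1, [tuple of r.2 :: p.2]) >>)
                   (braid (thead x) p.1))
           (braid_tuple [tuple of behead x] u)
  end.

(* The product of T(V) (x) T(V)^{(x) (m - 1)} as a braided tensor product
   A (x) B, that is (mu_A (x) mu_B) (id_A (x) Rcheck_{B, A} (x) id_B). *)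
Fixpoint mul_tuple (m : nat) : m.-tuple word -> m.-tuple word -> Tm m :=
  match m with
  | 0 => fun _ _ => << [tuple] >>
  | m'.+1 => fun x y =>
      mext (fun p : word * m'.-tuple word =>
              mext (fun z : m'.-tuple word =>
                      << [tuple of mmul (thead x) p.1 :: z] >>)
                   (mul_tuple p.2 [tuple of behead y]))
           (braid_tuple [tuple of behead x] (thead y))
  end.

Definition bmul (m : nat) (x y : Tm m) : Tm m :=
  mext (fun s => mext (fun t => mul_tuple s t) y) x.

(* t_1 (x) ... (x) x (x) ... (x) t_m, with x in position i. *)
Definition slot (m : nat) (t : m.-tuple word) (i : 'I_m)
    (x : TV) : Tm m :=
  mext (fun w => << [tuple (if s == i then w else tnth t s) | s < m] >>) x.

(* The kernel of the canonical map T(V)^{(x) m} -> S_q(V)^{(x) m}. *)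
Definition Am_ker (m : nat) : Tm m -> Prop :=
  in_span (fun x => exists (t : m.-tuple word) (i : 'I_m) (y : TV),
    Sq_ideal y /\ x = slot t i y).

(* Elements of A_m are represented in T(V)^{(x) m}, where bmul represents the
   braided product; eqA is equality in A_m. *)
Definition eqA (m : nat) (x y : Tm m) : Prop := Am_ker (x - y).

Definition X (m : nat) (i : 'I_m) (a : 'I_7) : Tm m :=
  << [tuple (if s == i then fmu a else mone) | s < m] >>.

Definition phi : 'M[K]_7 :=
  q ^+ 4 *: delta_mx p1 m1 + q ^- 6 *: delta_mx m1 p1
  + q ^+ 3 *: delta_mx p2 m2 + q ^- 5 *: delta_mx m2 p2
  + delta_mx p3 m3 + q ^- 2 *: delta_mx m3 p3 + delta_mx z0 z0.

Definition Phi (m : nat) (i j : 'I_m) : Tm m :=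
  \sum_(a < 7) \sum_(b < 7) phi a b *: bmul (X i a) (X j b).

Definition gamma_v1 : VV :=
  tens (bvec p1) (bvec z0) - q ^- 6 *: tens (bvec z0) (bvec p1)
  - (q ^- 3 + q^-1) *: (tens (bvec p2) (bvec p3)
                        - q ^- 3 *: tens (bvec p3) (bvec p2)).

Definition upsilon_coef (gamma : 'Hom(V, VV)) (a b c d : 'I_7) : K :=
  q ^+ 6 * \sum_(f < 7) \sum_(h < 7)
    phi f h * gamma (bvec f) a b * gamma (bvec h) c d.

Definition Upsilon (gamma : 'Hom(V, VV)) (m : nat) (i j k l : 'I_m) : Tm m :=
  \sum_(a < 7) \sum_(b < 7) \sum_(c < 7) \sum_(d < 7)
    upsilon_coef gamma a b c d *:
      bmul (bmul (bmul (X i a) (X j b)) (X k c)) (X l d).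

Definition dimqV : K :=
  q ^+ 10 + q ^+ 8 + q ^+ 2 + 1 + q ^- 2 + q ^- 8 + q ^- 10.

End QuantumG2.

Arguments X {R m} i a.
Arguments Phi {R m} i j.
Arguments Upsilon {R} gamma {m} i j k l.
Arguments dimqV {R}.
Arguments gamma_v1 {R}.

Notation "x ** y" := (bmul x y) (at level 40, left associativity) : ring_scope.
Notation "x =A y" := (eqA x y) (at level 70, no associativity) : ring_scope.

(* Main.v *)
(* On v_1 (x) V and by U_q-linearity the braiding of V with V is an explicit
   matrix: this matrix commutes with U_q, it has the prescribed eigenvalues on
   the highest weight vectors, and v_1 (x) v_{-1}, which generates V (x) V, lies
   in the sum of the submodules generated by these vectors; so it is Rcheck. With
   f(x) = (x - q^2)(x - q^-12), the image of f(Rcheck) lies in \wedge_q^2 V.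

   Left multiplication by X_{ia} in T(V)^{(x) m} pushes the letter a through the
   factors before the i-th one. By the Yang-Baxter equation these operators
   satisfy X_{ja} X_{ib} = Rcheck X_{ib} X_{ja} for i < j, and the images of
   f(Rcheck) in all factors span a subspace that they preserve and that vanishes
   in A_m. Sorting the four slots of each product of two Phi by these exchanges
   turns each relation into an identity in V^{(x) 4}, to be satisfied exactly or,
   when a slot occurs twice, modulo the image of f(Rcheck) at the two equal
   slots. The coefficients are Laurent polynomials in q with integral
   coefficients, so that these identities are checked by computation. The first
   relation reduces in the same way to phi (x) v_a = v_a (x) phi. *)

Require Import Defs.
From HB Require Import structures.
From Stdlib Require Import ZArith.
From mathcomp Require Import all_boot all_order all_algebra.
From mathcomp Require Import ssrZ zify ring.
From mathcomp Require Import reals.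
From mathcomp.real_closed Require Import complex.
From mathcomp.finmap Require Import finmap.
From mathcomp.multinomials Require Import monalg.
Delimit Scope Z_scope with Z.

Set Implicit Arguments.
Unset Strict Implicit.
Unset Printing Implicit Defensive.

Import GRing.Theory Num.Theory.
Local Open Scope ring_scope.

(** * Tensors over Laurent polynomials *)

(* (e, c) stands for c q^e; a tensor is a list of such monomials in front of
   words in the basis of V. *)
Definition mono : Type := (Z * Z)%type.
Definition laurent : Type := seq mono.
Definition tensor : Type := seq (seq 'I_7 * mono).

Definition mono_mul (s t : mono) : mono := ((s.1 + t.1)%Z, (s.2 * t.2)%Z).

Definition tscale (l : laurent) (v : tensor) : tensor :=
  flatten [seq [seq (t.1, mono_mul s t.2) | t <- v] | s <- l].

Definition tbind (v : tensor) (g : seq 'I_7 -> tensor) : tensor :=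
  flatten [seq [seq (s.1, mono_mul t.2 s.2) | s <- g t.1] | t <- v].

Definition qX (e : Z) : laurent := [:: (e, 1%Z)].
Definition qXN (e : Z) : laurent := [:: (e, (-1)%Z)].

Fixpoint word_cmp (u v : seq 'I_7) : comparison :=
  match u, v with
  | [::], [::] => Eq
  | [::], _ => Lt
  | _, [::] => Gt
  | a :: u', b :: v' =>
      match Nat.compare a b with Eq => word_cmp u' v' | c => c end
  end.

Definition term_le (s t : seq 'I_7 * mono) : bool :=
  match word_cmp s.1 t.1 with
  | Lt => true
  | Gt => false
  | Eq => Z.leb s.2.1 t.2.1
  end.

Fixpoint collect_from (t : seq 'I_7 * mono) (v : tensor) : tensor :=
  if v is s :: v' then
    if (s.1 == t.1) && Z.eqb s.2.1 t.2.1
    then collect_from (t.1, (t.2.1, (t.2.2 + s.2.2)%Z)) v'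
    else if Z.eqb t.2.2 0 then collect_from s v' else t :: collect_from s v'
  else if Z.eqb t.2.2 0 then [::] else [:: t].

Definition collect (v : tensor) : tensor :=
  if sort term_le v is t :: v' then collect_from t v' else [::].

Definition teq (v w : tensor) : bool :=
  nilp (collect (v ++ tscale (qXN 0) w)).

(* The value of q^64 l at q = 2, to detect nonzero l. *)
Definition laurent_at2 (l : laurent) : Z :=
  foldr (fun s z => (s.2 * 2 ^ (s.1 + 64) + z)%Z) 0%Z l.

Definition laurent_neq0 (l : laurent) : bool :=
  all (fun s => Z.leb 0 (s.1 + 64)) l && ~~ Z.eqb (laurent_at2 l) 0.

Lemma int_of_ZN z : int_of_Z (- z)%Z = - int_of_Z z.
Proof. exact: (rmorphN int_of_Z). Qed.

Section Evaluation.
Variable R : realType.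
Local Notation K := (Cq R).
Local Notation q := (@qv R).

Definition mono_ev (s : mono) : K :=
  (int_of_Z s.2)%:~R * q ^ int_of_Z s.1.

Definition laurent_ev (l : laurent) : K := \sum_(s <- l) mono_ev s.

(** Words are evaluated by an arbitrary function into an arbitrary module, so that a formal identity
    checked once can be read in V (x) V, in T(V) or for operators on T(V)^{(x) m}. *)
Definition tensor_ev (U : lmodType K) (v : tensor) (f : seq 'I_7 -> U) : U :=
  \sum_(t <- v) mono_ev t.2 *: f t.1.

Lemma qv_neq0 : q != 0.
Proof. by rewrite /qv tofrac_eq0 polyX_eq0. Qed.

Lemma mono_ev_mul s t : mono_ev (mono_mul s t) = mono_ev s * mono_ev t.
Proof.
rewrite /mono_ev /mono_mul /=.
rewrite [int_of_Z (Z.mul _ _)](rmorphM int_of_Z) [int_of_Z (Z.add _ _)](rmorphD int_of_Z).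
by rewrite intrM expfzDr ?qv_neq0 // mulrACA.
Qed.

Lemma mono_ev_pos e : mono_ev (e, 1%Z) = q ^ int_of_Z e.
Proof. by rewrite /mono_ev mul1r. Qed.

Lemma mono_ev_neg e : mono_ev (e, (-1)%Z) = - q ^ int_of_Z e.
Proof. by rewrite /mono_ev mulN1r. Qed.

Lemma laurent_ev_qX e : laurent_ev (qX e) = q ^ int_of_Z e.
Proof. by rewrite /laurent_ev big_seq1 /mono_ev mul1r. Qed.

Lemma laurent_ev_qXN e : laurent_ev (qXN e) = - q ^ int_of_Z e.
Proof. by rewrite /laurent_ev big_seq1 /mono_ev mulN1r. Qed.

Section Module.
Variable U : lmodType K.
Implicit Types (v w : tensor) (f : seq 'I_7 -> U).

Lemma tensor_ev_nil f : tensor_ev [::] f = 0.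
Proof. exact: big_nil. Qed.

Lemma tensor_ev_cat v w f : tensor_ev (v ++ w) f = tensor_ev v f + tensor_ev w f.
Proof. exact: big_cat. Qed.

Lemma tensor_ev_scale l v f :
  tensor_ev (tscale l v) f = laurent_ev l *: tensor_ev v f.
Proof.
rewrite /tensor_ev big_flatten big_map scaler_suml; apply: eq_bigr => s _.
rewrite big_map scaler_sumr; apply: eq_bigr => t _ /=.
by rewrite mono_ev_mul scalerA.
Qed.

Lemma tensor_ev_bind v g f :
  tensor_ev (tbind v g) f = tensor_ev v (fun u => tensor_ev (g u) f).
Proof.
rewrite /tensor_ev big_flatten big_map; apply: eq_bigr => s _.
rewrite big_map scaler_sumr; apply: eq_bigr => t _ /=.
by rewrite mono_ev_mul scalerA.
Qed.

Lemma eq_tensor_ev v f f' : f =1 f' -> tensor_ev v f = tensor_ev v f'.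
Proof. by move=> ff'; apply: eq_bigr => t _; rewrite ff'. Qed.

Lemma tensor_ev_collect_from t v f :
  tensor_ev (collect_from t v) f = tensor_ev (t :: v) f.
Proof.
have tnil s : Z.eqb s.2.2 0 -> mono_ev s.2 *: f s.1 = 0.
  by move=> /Z.eqb_eq s0; rewrite /mono_ev s0 mul0r scale0r.
elim: v t => [|s v IH] t /=.
  by case: ifP => // /tnil t0; rewrite /tensor_ev big_seq1 big_nil t0.
case: ifP => [/andP[/eqP st /Z.eqb_eq e]|_].
  rewrite IH /tensor_ev !big_cons /= addrA; congr (_ + _).
  rewrite -st -scalerDl; congr (_ *: _); rewrite /mono_ev /= e -mulrDl.
  by rewrite [int_of_Z (Z.add _ _)](rmorphD int_of_Z) intrD.
case: ifP => [/tnil t0|_]; last first.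
  rewrite {1}/tensor_ev big_cons -[X in _ + X]/(tensor_ev _ f) IH.
  by rewrite /tensor_ev [in RHS]big_cons.
by rewrite IH /tensor_ev [in RHS]big_cons t0 add0r.
Qed.

(** Sorting permutes the terms and merging adds coefficients of adjacent equal monomials; the order
    [term_le] serves to bring like terms together. *)
Lemma tensor_ev_collect v f : tensor_ev (collect v) f = tensor_ev v f.
Proof.
rewrite /collect {2}/tensor_ev -(perm_big _ (permEl (perm_sort term_le v))) /=.
by case: (sort _ _) => // t w; rewrite tensor_ev_collect_from.
Qed.

Lemma teqP v w f : teq v w -> tensor_ev v f = tensor_ev w f.
Proof.
move=> /nilP e; apply/eqP; rewrite -subr_eq0; apply/eqP.
have <- : tensor_ev (v ++ tscale (qXN 0) w) f = 0.
  by rewrite -tensor_ev_collect e tensor_ev_nil.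
by rewrite tensor_ev_cat tensor_ev_scale laurent_ev_qXN expr0z scaleN1r.
Qed.

End Module.

Lemma tensor_ev_linear (U W : lmodType K) (h : {linear U -> W}) v f :
  h (tensor_ev v f) = tensor_ev v (fun u => h (f u)).
Proof. by rewrite linear_sum; apply: eq_bigr => t _; rewrite linearZ. Qed.

(** All exponents are at least -64, so q^64 l is a genuine polynomial p; if l were zero, then p and
    its integer value at 2 would be zero. *)
Lemma laurent_neq0P l : laurent_neq0 l -> laurent_ev l != 0.
Proof.
case/andP=> /allP e0 v0; apply/eqP => l0.
pose p : {poly R[i]} :=
  \sum_(s <- l) (int_of_Z s.2)%:~R *: 'X^(Z.to_nat (s.1 + 64)).
have p0 : p = 0.
  apply/eqP; rewrite -tofrac_eq0 -(mulr0 (q ^+ 64)) -l0 mulr_sumr rmorph_sum /=.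
  apply/eqP/eq_big_seq => s /e0 /Z.leb_le se.
  rewrite scaler_int raddfMz /= rmorphXn /= -mulrzl -/qv /mono_ev.
  rewrite [RHS]mulrCA; congr (_ * _).
  rewrite !exprnP -expfzDr ?qv_neq0 //.
  congr (_ ^ _).
  have -> : Posz 64 = int_of_Z 64 by [].
  have intN z : (0 <= z)%Z -> Posz (Z.to_nat z) = int_of_Z z by case: z.
  by rewrite intN // -(rmorphD int_of_Z) addrC.
have := congr1 (horner^~ 2%:R) p0; rewrite horner0 horner_sum => h.
move/negP: v0; apply.
have -> : laurent_at2 l = 0; last by [].
apply: (can_inj int_of_ZK); apply/eqP.
rewrite -(intr_eq0 R[i]) -[X in _ == X]h; apply/eqP.
elim: l e0 {l0 p0 p h} => [|s l IH] e0; first by rewrite big_nil.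
rewrite big_cons -IH => [|t tl]; last by apply: e0; rewrite inE tl orbT.
have -> : laurent_at2 (s :: l) = (s.2 * 2 ^ (s.1 + 64) + laurent_at2 l)%Z by [].
rewrite [int_of_Z (Z.add _ _)](rmorphD int_of_Z) intrD; congr (_ + _).
rewrite [X in X%:~R = _](rmorphM int_of_Z) intrM hornerZ hornerXn; congr (_ * _).
have /Z.leb_le se := e0 s (mem_head _ _).
rewrite -[in LHS](Z2Nat.id (s.1 + 64)) //; elim: (Z.to_nat _) => [|n IHn] //.
rewrite Nat2Z.inj_succ Z.pow_succ_r; last lia.
by rewrite [X in X%:~R = _](rmorphM int_of_Z) intrM IHn exprS.
Qed.

End Evaluation.

(** * The action and the braiding on V (x) V *)

Definition letters : seq 'I_7 := [:: p1; p2; p3; z0; m3; m2; m1].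

Lemma mem_letters a : a \in letters.
Proof.
case: a => [n ltn7]; rewrite -(mem_map val_inj) /=.
by move: n ltn7; do 7?[case=> //].
Qed.

Lemma all_letters (P : pred 'I_7) : all P letters -> forall a, P a.
Proof. by move=> /allP allP_ a; apply/allP_/mem_letters. Qed.

Lemma letter_ind (P : 'I_7 -> Prop) :
  P p1 -> P p2 -> P p3 -> P z0 -> P m3 -> P m2 -> P m1 -> forall a, P a.
Proof.
move=> h1 h2 h3 h4 h5 h6 h7 a; have := mem_letters a; rewrite !inE.
by do 6?[case/orP]; move/eqP->.
Qed.

Definition weight_exp (i : 'I_2) (a : 'I_7) : Z :=
  nth 0%Z (if i == ord0 then [:: 1; -1; 2; 0; -2; 1; -1]
           else [:: 0; 3; -3; 0; 3; -3; 0])%Z a.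

Definition E_letter (i : 'I_2) (a : 'I_7) : tensor :=
  nth [::]
    (if i == ord0 then
       [:: [::]; [:: ([:: p1], (0, 1))]; [::];
           [:: ([:: p3], (1, 1)); ([:: p3], (-1, 1))];
           [:: ([:: z0], (1, -1)); ([:: z0], (-1, -1))];
           [::]; [:: ([:: m2], (0, -1))]]
     else
       [:: [::]; [::]; [:: ([:: p2], (0, 1))]; [::]; [::];
           [:: ([:: m3], (0, -1))]; [::]])%Z a.

Definition F_letter (i : 'I_2) (a : 'I_7) : tensor :=
  nth [::]
    (if i == ord0 then
       [:: [:: ([:: p2], (0, 1))]; [::]; [:: ([:: z0], (0, 1))];
           [:: ([:: m3], (0, -1))]; [::]; [:: ([:: m1], (0, -1))]; [::]]
     else
       [:: [::]; [:: ([:: p3], (0, 1))]; [::]; [::];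
           [:: ([:: m2], (0, -1))]; [::]; [::]])%Z a.

Definition tens_letters (u v : tensor) : tensor :=
  tbind u (fun x => [seq (x ++ t.1, t.2) | t <- v]).

Definition tletter (e : Z) (a : 'I_7) : tensor := [:: ([:: a], (e, 1%Z))].

Definition act_word (g : Uqgen) (w : seq 'I_7) : tensor :=
  let a := nth p1 w 0 in let b := nth p1 w 1 in
  match g with
  | gE i => tens_letters (E_letter i a) (tletter (weight_exp i b) b)
            ++ tens_letters (tletter 0 a) (E_letter i b)
  | gF i => tens_letters (F_letter i a) (tletter 0 b)
            ++ tens_letters (tletter (- weight_exp i a) a) (F_letter i b)
  | gK i => tens_letters (tletter (weight_exp i a) a) (tletter (weight_exp i b) b)
  | gKV i => tens_letters (tletter (- weight_exp i a) a)
                          (tletter (- weight_exp i b) b)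
  end.

(* Rcheck is computed from its values q^(lambda_1, wt v_b) v_b (x) v_1 on
   v_1 (x) v_b: since it commutes with F_i,
   Rcheck (F_i v_a (x) v_b) =
     F_i (Rcheck (v_a (x) v_b)) - Rcheck (K_i^-1 v_a (x) F_i v_b),
   and v_{a+1} = +- F_i v_a in the order of the basis. *)
Definition R_top : seq tensor :=
  [seq [:: ([:: t.1; p1], (t.2, 1%Z))]
     | t <- zip letters [:: 2; 1; 1; 0; -1; -1; -2]%Z].

Definition R_next (s : 'I_7 * 'I_2 * Z) (r : seq tensor) : seq tensor :=
  let: (a, i, c) := s in
  [seq collect (tscale [:: (0%Z, c)]
     (tbind (nth [::] r (val b)) (act_word (gF i)) ++
      tscale (qXN (- weight_exp i a))
        (tbind (F_letter i b) (fun w => nth [::] r (val (nth p1 w 0))))))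
     | b <- letters].

Definition R_table : seq (seq tensor) := Eval vm_compute in
  R_top :: scanl (fun r s => R_next s r) R_top
    [:: (p1, ord0, 1%Z); (p2, ord_max, 1%Z); (p3, ord0, 1%Z);
        (z0, ord0, (-1)%Z); (m3, ord_max, (-1)%Z); (m2, ord0, (-1)%Z)].

Definition R_letters (a b : 'I_7) : tensor := nth [::] (nth [::] R_table a) b.

Definition R_word (w : seq 'I_7) : tensor := R_letters (nth p1 w 0) (nth p1 w 1).

Definition uqgens : seq Uqgen :=
  [:: gE ord0; gE ord_max; gF ord0; gF ord_max;
      gK ord0; gK ord_max; gKV ord0; gKV ord_max].

Lemma R_word_act_check :
  all (fun g => all (fun a => all (fun b =>
    teq (tbind (act_word g [:: a; b]) R_word)
        (tbind (R_word [:: a; b]) (act_word g))) letters) letters) uqgens.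
Proof. by vm_compute. Qed.

(** * The action by matrices compared with the action on words *)

Section Operators.
Variable R : realType.
Local Notation K := (Cq R).
Local Notation q := (@qv R).
Local Notation VV := 'M[K]_7.

Lemma weight_expE i a : int_of_Z (weight_exp i a) = (wtK i)`_a.
Proof.
by elim/letter_ind: a; case: i => [[|[|//]] lti]; vm_compute.
Qed.

Section RowSums.
Variables (U : lmodType K) (G : 'I_7 -> U).

(** The image of v_a under M with each v_c replaced by G c; it links the rows of the matrices to the
    term lists [E_letter] and [F_letter]. *)
Definition row_comb (M : 'M[K]_7) (a : 'I_7) : U := \sum_c M a c *: G c.

Lemma row_combD M N a : row_comb (M + N) a = row_comb M a + row_comb N a.
Proof. by rewrite -big_split; apply: eq_bigr => c _; rewrite mxE scalerDl. Qed.

Lemma row_combZ x M a : row_comb (x *: M) a = x *: row_comb M a.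
Proof. by rewrite scaler_sumr; apply: eq_bigr => c _; rewrite mxE scalerA. Qed.

Lemma row_combN M a : row_comb (- M) a = - row_comb M a.
Proof. by rewrite -[- M]scaleN1r row_combZ scaleN1r. Qed.

Lemma row_comb_delta x y a :
  row_comb (delta_mx x y) a = if a == x then G y else 0.
Proof.
rewrite /row_comb (bigD1 y) //= big1 => [|c /negPf ncy]; last first.
  by rewrite mxE ncy andbF scale0r.
by rewrite mxE eqxx andbT addr0; case: ifP; rewrite (scale1r, scale0r).
Qed.

Definition row_combE := (row_combD, row_combN, row_combZ, row_comb_delta).

Lemma row_comb_actE i a :
  row_comb (actE R i) a = tensor_ev (E_letter i a) (fun w => G (nth p1 w 0)).
Proof.
rewrite /actE /E_letter; case: ifP => _; rewrite !row_combE.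
all: elim/letter_ind: a.
all: simpl (if _ then _ else _).
all: rewrite ?(scaler0, oppr0, addr0, add0r, subr0, sub0r).
all: rewrite ?[nth _ _ _]/= /tensor_ev ?big_cons !big_nil ?addr0.
all: rewrite ?[nth p1 _ _]/= ?mono_ev_pos ?mono_ev_neg ?expr0z ?scale1r ?scaleN1r //.
all: by rewrite expr1z exprN1 ?scaleNr scalerDl ?opprD.
Qed.

Lemma row_comb_actF i a :
  row_comb (actF R i) a = tensor_ev (F_letter i a) (fun w => G (nth p1 w 0)).
Proof.
rewrite /actF /F_letter; case: ifP => _; rewrite !row_combE.
all: elim/letter_ind: a.
all: simpl (if _ then _ else _).
all: rewrite ?(scaler0, oppr0, addr0, add0r, subr0, sub0r).
all: rewrite ?[nth _ _ _]/= /tensor_ev ?big_cons !big_nil ?addr0.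
all: rewrite ?[nth p1 _ _]/= ?mono_ev_pos ?mono_ev_neg ?expr0z ?scale1r ?scaleN1r //.
Qed.

Lemma row_comb_diag (d : 'rV[K]_7) a : row_comb (diag_mx d) a = d 0 a *: G a.
Proof.
rewrite /row_comb (bigD1 a) //= big1 => [|c /negPf nca]; last first.
  by rewrite mxE eq_sym nca mulr0n scale0r.
by rewrite mxE eqxx mulr1n addr0.
Qed.

Lemma row_comb1 a : row_comb 1%:M a = G a.
Proof.
by rewrite -diag_const_mx row_comb_diag mxE scale1r.
Qed.

End RowSums.

Lemma invmx_actK i :
  invmx (actK R i) = diag_mx (\row_a q ^ - (wtK i)`_a).
Proof.
have KV : actK R i *m diag_mx (\row_a q ^ - (wtK i)`_a) = 1%:M.
  rewrite /actK mulmx_diag -diag_const_mx; congr diag_mx.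
  apply/rowP => a; rewrite !mxE -expfzDr ?qv_neq0 //.
  by rewrite addrN expr0z.
by have /mulmx1_unit[Ku _] := KV; rewrite -[RHS](mulKmx Ku) KV mulmx1.
Qed.

Definition dlt (w : seq 'I_7) : VV := delta_mx (nth p1 w 0) (nth p1 w 1).

Lemma tensop_delta (A B : 'M[K]_7) a b :
  tensop A B (delta_mx a b) =
  row_comb (fun c => row_comb (fun d => delta_mx c d) B b) A a.
Proof.
rewrite lfunE /= {1}(matrix_sum_delta (_ *m _)); apply: eq_bigr => c _.
rewrite scaler_sumr; apply: eq_bigr => d _; rewrite scalerA; congr (_ *: _).
rewrite mxE (bigD1 b) //= big1 => [|e /negPf neb]; last first.
  rewrite mxE (bigD1 a) //= big1 => [|f /negPf nfa]; last first.
    by rewrite !mxE nfa mulr0.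
  by rewrite !mxE neb andbF mulr0 addr0 mul0r.
rewrite mxE (bigD1 a) //= big1 => [|f /negPf nfa]; last first.
  by rewrite !mxE nfa mulr0.
by rewrite !mxE !eqxx mulr1 !addr0.
Qed.

Lemma tensor_ev_tens_letters (U : lmodType K) u v (f : seq 'I_7 -> U) :
  tensor_ev (tens_letters u v) f =
  tensor_ev u (fun x => tensor_ev v (fun y => f (x ++ y))).
Proof.
rewrite tensor_ev_bind; apply: eq_tensor_ev => x.
by rewrite /tensor_ev big_map.
Qed.

Lemma tensor_ev_tletter (U : lmodType K) e a (f : seq 'I_7 -> U) :
  tensor_ev (tletter e a) f = q ^ int_of_Z e *: f [:: a].
Proof. by rewrite /tensor_ev big_seq1 /mono_ev /= mul1r. Qed.

Definition letter_headed (v : tensor) := all (fun t => size t.1 == 1%N) v.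

Lemma tensor_ev_letter (U : lmodType K) v (f : seq 'I_7 -> U) :
  letter_headed v ->
  tensor_ev v f = tensor_ev v (fun w => f [:: nth p1 w 0]).
Proof.
move=> /allP hv; apply: eq_big_seq => t /hv; case: t => [] [|a []] //.
Qed.

Lemma actVV_delta g a b :
  actVV R g (delta_mx a b) = tensor_ev (act_word g [:: a; b]) dlt.
Proof.
have Eh i c : letter_headed (E_letter i c).
  by elim/letter_ind: c; case: i => [[|[|//]] lti].
have Fh i c : letter_headed (F_letter i c).
  by elim/letter_ind: c; case: i => [[|[|//]] lti].
case: g => i; rewrite /actVV ?add_lfunE !tensop_delta /act_word
  [nth p1 _ 0]/= [nth p1 _ 1]/=.
- rewrite tensor_ev_cat !tensor_ev_tens_letters tensor_ev_tletter.
  rewrite row_comb_actE [X in _ = X + _](tensor_ev_letter _ (Eh _ _)).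
  apply: f_equal2.
    apply: eq_tensor_ev => w; rewrite tensor_ev_tletter row_comb_diag mxE.
    by rewrite weight_expE.
  rewrite row_comb1 row_comb_actE expr0z scale1r.
  by rewrite [RHS](tensor_ev_letter _ (Eh _ _)).
- rewrite tensor_ev_cat !tensor_ev_tens_letters tensor_ev_tletter.
  rewrite row_comb_actF [X in _ = X + _](tensor_ev_letter _ (Fh _ _)).
  apply: f_equal2.
    by apply: eq_tensor_ev => w; rewrite tensor_ev_tletter row_comb1 expr0z scale1r.
  rewrite invmx_actK row_comb_diag mxE row_comb_actF int_of_ZN weight_expE.
  by rewrite [X in _ = _ *: X](tensor_ev_letter _ (Fh _ _)).
- by rewrite tensor_ev_tens_letters !row_comb_diag !mxE !tensor_ev_tletter !weight_expE.
- rewrite tensor_ev_tens_letters invmx_actK !row_comb_diag !mxE !tensor_ev_tletter.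
  by rewrite !int_of_ZN !weight_expE.
Qed.

End Operators.

(** * Highest weight vectors of V (x) V *)

Definition gamma_top : tensor :=
  [:: ([:: p1; z0], (0, 1)); ([:: z0; p1], (-6, -1));
      ([:: p2; p3], (-3, -1)); ([:: p2; p3], (-1, -1));
      ([:: p3; p2], (-6, 1)); ([:: p3; p2], (-4, 1))]%Z.

(** Each vector starts with its only term in v_1 (x) V, with coefficient 1. The vector of weight
    [lambda1] is gamma(v_1), and the invariant one is q^-4 times [phi]. *)
Definition highest_vector (mu : weight) : tensor :=
  if mu == (4, 2) then [:: ([:: p1; p1], (0, 1))]%Z
  else if mu == lambda2 then
    [:: ([:: p1; p2], (0, 1)); ([:: p2; p1], (-1, -1))]%Z
  else if mu == lambda1 then gamma_top
  else
    [:: ([:: p1; m1], (0, 1)); ([:: p2; m2], (-1, 1)); ([:: p3; m3], (-4, 1));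
        ([:: z0; z0], (-4, 1)); ([:: m3; p3], (-6, 1));
        ([:: m2; p2], (-9, 1)); ([:: m1; p1], (-10, 1))]%Z.

Definition R_eigen_mono (mu : weight) : mono :=
  if mu == (4, 2) then (2, 1)%Z else if mu == lambda2 then (0, -1)%Z
  else if mu == lambda1 then (-6, -1)%Z else (-12, 1)%Z.

Definition index2 : seq 'I_2 := [:: ord0; ord_max].

Lemma highest_vector_check :
  all (fun mu =>
    teq (tbind (highest_vector mu) R_word)
        (tscale [:: R_eigen_mono mu] (highest_vector mu)) &&
    all (fun i =>
      teq (tbind (highest_vector mu) (act_word (gE i))) [::] &&
      teq (tbind (highest_vector mu) (act_word (gK i)))
        (tscale (qX (Z_of_int (form_weight i mu))) (highest_vector mu))) index2)
    VV_weights.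
Proof. by vm_compute. Qed.

(* A highest weight vector is determined by its component in v_1 (x) V, and
   the weight of this component leaves a single v_1 (x) v_b. *)
Definition highest_letter (mu : weight) : 'I_7 :=
  nth p1 (head (([::], (0, 0)))%Z (highest_vector mu)).1 1.

Lemma highest_letter_check :
  all (fun mu => all (fun b => (b == highest_letter mu) ||
    has (fun i => weight_exp i p1 + weight_exp i b
                  != Z_of_int (form_weight i mu)) index2) letters) VV_weights.
Proof. by vm_compute. Qed.

Definition lower_word (v : tensor) (s : seq 'I_2) : tensor :=
  foldl (fun v i => tbind v (act_word (gF i))) v s.

Definition even_laurent (e : Z) (l : seq Z) : laurent :=
  [seq (e + 2 * Z.of_nat t.1, t.2)%Z | t <- zip (iota 0 (size l)) l].

(* A multiple of v_1 (x) v_{-1} as a combination of vectors F_{i_1} ... F_{i_k} w,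
   w a highest weight vector; found by solving a linear system of size 7. *)
Definition span_denominator : laurent :=
  even_laurent 0 [:: 1; 4; 7; 7; 6; 9; 15; 17; 13; 10; 13; 17; 15; 9; 6; 7; 7;
    4; 1]%Z.

Definition span_certificate : seq (weight * seq 'I_2 * laurent) :=
  let s : 'I_2 := ord0 in let l : 'I_2 := ord_max in
  [:: ((4, 2), [:: s; s; l; s; s; l],
        even_laurent 6 [:: 1; 2; 2; 0; 0; 2; 4; 2; 0; 0; 2; 2; 1]%Z);
      ((4, 2), [:: s; s; l; s; l; s],
        even_laurent 5 [:: 1; 4; 6; 4; 1; 3; 8; 8; 3; 1; 4; 6; 4; 1]%Z);
      ((4, 2), [:: s; l; s; s; l; s],
        even_laurent 4 [:: -1; -3; -5; -5; -3; -3; -6; -8; -6; -3; -3; -5; -5;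
          -3; -1]%Z);
      (lambda2, [:: l; s; s; s; l],
        even_laurent 8 [:: 1; 2; 2; 2; 3; 4; 4; 3; 2; 2; 2; 1]%Z);
      (lambda2, [:: l; s; s; l; s],
        even_laurent 5 [:: -1; -2; -2; -3; -5; -6; -6; -6; -6; -6; -5; -3; -2;
          -2; -1]%Z);
      (lambda1, [:: s; l; s],
        even_laurent 12 [:: -1; -3; -3; -1; -1; -3; -4; -3; -1; -1; -3; -3;
          -1]%Z);
      ((0, 0), [::], even_laurent 20 [:: 1; 3; 4; 3; 2; 3; 4; 3; 1]%Z)].

(** The zero weight space of V (x) V has dimension 7 and meets V_{2 lambda_1}, V_{lambda_2},
    V_{lambda_1}, V_0 in dimensions 3, 2, 1, 1: these are the numbers of vectors that the
    certificate takes from each. *)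
Lemma span_certificate_check :
  all (fun t => t.1.1 \in VV_weights) span_certificate &&
  teq (tscale span_denominator [:: ([:: p1; m1], (0, 1)%Z)])
    (flatten [seq tscale t.2 (lower_word (highest_vector t.1.1) t.1.2)
                | t <- span_certificate]).
Proof. by vm_compute. Qed.

(** * Decomposition of V (x) V and identification of [Rcheck] *)

Section RCheck.
Variable R : realType.
Local Notation K := (Cq R).
Local Notation q := (@qv R).
Local Notation VV := 'M[K]_7.
Local Notation dlt := (@dlt R).

Lemma index2_ind (P : 'I_2 -> Prop) : P ord0 -> P ord_max -> forall i, P i.
Proof.
move=> P0 P1 [[|[|//]] lti]; first by rewrite (_ : Ordinal lti = ord0) //; apply: val_inj.
by rewrite (_ : Ordinal lti = ord_max) //; apply: val_inj.
Qed.

Lemma uqgen_all (P : pred Uqgen) : all P uqgens -> forall g, P g.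
Proof.
rewrite /= => /and5P[? ? ? ? /and5P[? ? ? ? _]].
by case; apply: index2_ind.
Qed.

Lemma eq_lfun_delta (U : vectType K) (f g : 'Hom(VV, U)) :
  (forall a b, f (delta_mx a b) = g (delta_mx a b)) -> f = g.
Proof.
move=> fg; apply/lfunP => v; rewrite (matrix_sum_delta v) !linear_sum.
apply: eq_bigr => a _; rewrite !linear_sum; apply: eq_bigr => b _.
by rewrite !linearZ /= fg.
Qed.

Definition word_map (g : seq 'I_7 -> tensor) (v : VV) : VV :=
  \sum_a \sum_b v a b *: tensor_ev (g [:: a; b]) dlt.

Lemma word_map_is_linear g : linear (word_map g).
Proof.
move=> x u v; rewrite /word_map scaler_sumr -big_split; apply: eq_bigr => a _.
rewrite scaler_sumr -big_split; apply: eq_bigr => b _.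
by rewrite !mxE scalerDl scalerA.
Qed.

HB.instance Definition _ g :=
  GRing.isLinear.Build K VV VV _ (word_map g) (word_map_is_linear g).

Definition Rmap : 'End(VV) := linfun (word_map R_word).

Lemma Rmap_delta a b : Rmap (delta_mx a b) = tensor_ev (R_word [:: a; b]) dlt.
Proof.
have -> : Rmap (delta_mx a b) = word_map R_word (delta_mx a b) by exact: lfunE.
pose G c d : VV := tensor_ev (R_word [:: c; d]) dlt.
transitivity (\sum_(c | c == a) G c b); last by rewrite big_pred1_eq.
by rewrite [RHS]big_mkcond; apply: eq_bigr => c _; rewrite -row_comb_delta.
Qed.

Lemma Rmap_tensor v : Rmap (tensor_ev v dlt) = tensor_ev (tbind v R_word) dlt.
Proof.
rewrite tensor_ev_linear tensor_ev_bind; apply: eq_tensor_ev => w.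
exact: Rmap_delta.
Qed.

Lemma actVV_tensor g v :
  actVV R g (tensor_ev v dlt) = tensor_ev (tbind v (act_word g)) dlt.
Proof.
rewrite tensor_ev_linear tensor_ev_bind; apply: eq_tensor_ev => w.
exact: actVV_delta.
Qed.

Lemma Rmap_actVV g v : Rmap (actVV R g v) = actVV R g (Rmap v).
Proof.
suff e : (Rmap \o actVV R g = actVV R g \o Rmap)%VF.
  by have := congr1 (fun f : 'End(VV) => f v) e; rewrite !comp_lfunE.
apply: eq_lfun_delta => a b; rewrite !comp_lfunE actVV_delta Rmap_delta.
rewrite Rmap_tensor actVV_tensor.
have /all_letters/(_ a)/all_letters/(_ b) := uqgen_all R_word_act_check g.
exact: teqP.
Qed.

Section Submodules.
Implicit Types U W : {vspace VV}.

Definition is_submod W := forall g, (actVV R g @: W <= W)%VS.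

Lemma submod_step_le U W : is_submod W -> (U <= W)%VS ->
  (submod_step U <= W)%VS.
Proof.
move=> Wsub UW; have gW g : (actVV R g @: U <= W)%VS.
  exact: subv_trans (limgS _ UW) (Wsub g).
have add2 (A B : {vspace VV}) : (A <= W)%VS -> (B <= W)%VS -> (A + B <= W)%VS.
  by move=> AW BW; rewrite subv_add AW.
apply: (add2 _ _ UW); apply/subv_sumP => i _.
exact: add2 (add2 _ _ (add2 _ _ (gW _) (gW _)) (gW _)) (gW _).
Qed.

Lemma submod_gen_le U W : is_submod W -> (U <= W)%VS -> (submod_gen U <= W)%VS.
Proof.
move=> Wsub UW; rewrite /submod_gen; move: (7 * 7)%N; elim=> [|n IH] //.
rewrite iterS; exact: submod_step_le.
Qed.

Lemma sub_submod_step U : (U <= submod_step U)%VS.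
Proof. exact: addvSl. Qed.

Lemma sub_submod_gen U : (U <= submod_gen U)%VS.
Proof.
rewrite /submod_gen; move: (7 * 7)%N; elim=> [|n IH]; first exact: subvv.
rewrite iterS; exact: subv_trans IH (sub_submod_step _).
Qed.

(** A step that is not yet stable raises the dimension by at least one, so after 49 steps the space
    is either stable or all of V (x) V. *)
Lemma submod_step_gen U : submod_step (submod_gen U) = submod_gen U.
Proof.
have step n : (n <= \dim (iter n (@submod_step R) U))%N \/
    submod_step (iter n (@submod_step R) U) = iter n (@submod_step R) U.
  elim: n => [|n [len|e]]; [by left| |by right; rewrite /= !e].
  have [e|ne] := eqVneq (iter n (@submod_step R) U) (iter n.+1 (@submod_step R) U).
    by right; rewrite -e; exact: esym e.
  left; apply: leq_trans (_ : (\dim (iter n (@submod_step R) U) < _)%N); first by [].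
  by rewrite ltnNge; apply: contra ne; rewrite eqEdim sub_submod_step.
have [d49|//] := step (7 * 7)%N.
have full : (fullv <= submod_gen U)%VS.
  have: (submod_gen U <= fullv)%VS by exact: subvf.
  move=> /dimv_leqif_sup/geq_leqif <-; rewrite dimvf /dim /=.
  exact: d49.
apply: subv_anti; apply/andP; split; last exact: sub_submod_step.
exact: subv_trans (subvf _) full.
Qed.

Lemma submod_gen_submod U : is_submod (submod_gen U).
Proof.
case=> i; rewrite -{2}submod_step_gen; apply: subv_trans (addvSr _ _);
  apply: subv_trans (sumv_sup i _ (subvv _)) => //.
- exact: subv_trans (addvSl _ _) (subv_trans (addvSl _ _) (addvSl _ _)).
- exact: subv_trans (addvSr _ _) (subv_trans (addvSl _ _) (addvSl _ _)).
- exact: subv_trans (addvSr _ _) (addvSl _ _).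
- exact: addvSr.
Qed.

End Submodules.

Definition hw_vector (mu : weight) : VV := tensor_ev (highest_vector mu) dlt.

Definition R_eigenvalue (mu : weight) : K := mono_ev R (R_eigen_mono mu).

Lemma hw_vector_eigen mu : mu \in VV_weights ->
  Rmap (hw_vector mu) = R_eigenvalue mu *: hw_vector mu.
Proof.
move=> /(allP highest_vector_check)/andP[/(@teqP R _ _ _ dlt) e _].
by rewrite Rmap_tensor e tensor_ev_scale /laurent_ev big_seq1.
Qed.

Lemma index2_all (P : pred 'I_2) : all P index2 -> forall i, P i.
Proof. by move=> /and3P[P0 P1 _]; apply: index2_ind. Qed.

Lemma memv_leigenspace (F : fieldType) (W : vectType F) (f : 'End(W)) x v :
  (v \in passmx.leigenspace f x) = (f v == x *: v).
Proof.
by rewrite memv_ker add_lfunE opp_lfunE scale_lfunE id_lfunE subr_eq0.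
Qed.

Lemma memv_hw_space mu v :
  reflect (forall i, actVV R (gE i) v = 0 /\
             actVV R (gK i) v = q ^ form_weight i mu *: v)
          (v \in hw_space R mu).
Proof.
rewrite memvE; apply: (iffP subv_bigcapP) => h i.
  have := h i isT; rewrite -memvE => /memv_capP[vE vK]; split.
    by apply/eqP; rewrite -memv_ker.
  by apply/eqP; rewrite -memv_leigenspace.
move=> _; have [e k] := h i; rewrite -memvE; apply/memv_capP; split.
  by rewrite memv_ker; apply/eqP.
by rewrite memv_leigenspace; apply/eqP.
Qed.

Lemma hw_vector_in mu : mu \in VV_weights -> hw_vector mu \in hw_space R mu.
Proof.
move=> /(allP highest_vector_check)/andP[_ /index2_all h].
apply/memv_hw_space => i; have /andP[e k] := h i; rewrite !actVV_tensor.
rewrite (teqP _ e) (teqP _ k) tensor_ev_nil tensor_ev_scale laurent_ev_qX.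
by rewrite Z_of_intK.
Qed.

Lemma tensopE (A B : 'M[K]_7) v : tensop A B v = A^T *m v *m B.
Proof. exact: lfunE. Qed.

Lemma actE_entry i a c :
  all (fun d => all (fun t => (nth p1 t.1 0 == c) == (d == a)) (E_letter i d))
    letters ->
  forall d, actE R i d c =
    if d == a then laurent_ev R [seq t.2 | t <- E_letter i a] else 0.
Proof.
move=> /all_letters h d; pose G e : K^o := if e == c then 1 else 0.
have -> : actE R i d c = row_comb G (actE R i) d.
  rewrite /row_comb /G (bigD1 c) //= eqxx [_ *: _]mulr1 big1 ?addr0 // => e /negPf->.
  exact: mulr0.
have {}h t : t \in E_letter i d -> (nth p1 t.1 0 == c) = (d == a).
  by move=> /(allP (h d))/eqP.
rewrite row_comb_actE /laurent_ev big_map; case: eqP h => [->|_] h.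
  by apply: eq_big_seq => t /h; rewrite /G => ->; apply: mulr1.
rewrite /tensor_ev big_seq big1 // => t /h; rewrite /G => ->.
exact: mulr0.
Qed.

(* Row c of E_i v is the sum of l times row a of v, acted on by K_i, and of
   row c of v, acted on by E_i. *)
Lemma E_kernel_row i a c (l := [seq t.2 | t <- E_letter i a]) v :
  laurent_neq0 l &&
  all (fun d => all (fun t => (nth p1 t.1 0 == c) == (d == a)) (E_letter i d))
    letters ->
  actVV R (gE i) v = 0 -> row c v = 0 -> row a v = 0.
Proof.
move=> /andP[/(laurent_neq0P R) x0 /actE_entry Ec].
rewrite /actVV add_lfunE !tensopE trmx1 mul1mx => /(congr1 (row c)).
rewrite linearD /= 2!row_mul row0 => + vc; rewrite row_mul vc mul0mx addr0.
have -> : row c (actE R i)^T = laurent_ev R l *: delta_mx 0 a.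
  apply/rowP => d; rewrite !mxE Ec eqxx /= eq_sym.
  by case: ifP; rewrite ?mulr1 ?mulr0.
rewrite -!scalemxAl -rowE => /eqP; rewrite scaler_eq0 (negPf x0) /= => /eqP va.
have /mulmxK Ku : actK R i \in unitmx.
  rewrite unitmxE det_diag; apply: rpred_prod => d _.
  by rewrite mxE unitfE expfz_neq0 ?qv_neq0.
by rewrite -[LHS](Ku _) va mul0mx.
Qed.

Lemma hw_top_row v :
  (forall i, actVV R (gE i) v = 0) -> row p1 v = 0 -> v = 0.
Proof.
move=> Ev v1.
have v2 : row p2 v = 0 by apply: (E_kernel_row _ (Ev ord0) v1); vm_compute.
have v3 : row p3 v = 0 by apply: (E_kernel_row _ (Ev ord_max) v2); vm_compute.
have v0 : row z0 v = 0 by apply: (E_kernel_row _ (Ev ord0) v3); vm_compute.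
have w3 : row m3 v = 0 by apply: (E_kernel_row _ (Ev ord0) v0); vm_compute.
have w2 : row m2 v = 0 by apply: (E_kernel_row _ (Ev ord_max) w3); vm_compute.
have w1 : row m1 v = 0 by apply: (E_kernel_row _ (Ev ord0) w2); vm_compute.
by apply/row_matrixP; apply: letter_ind; rewrite row0.
Qed.

Lemma qv_expz_inj : injective (fun n : int => q ^ n).
Proof.
have q1 k : q ^+ k.+1 != 1.
  rewrite -rmorphXn -(rmorph1 (@tofrac {poly R[i]})) /= tofrac_eq.
  apply/eqP => /(congr1 (fun p : {poly R[i]} => size p)).
  by rewrite size_polyXn size_poly1.
move=> m n /= e; apply/eqP; rewrite -subr_eq0; apply/eqP.
have : q ^ (m - n) = 1.
  by rewrite expfzDr ?qv_neq0 // e -expfzDr ?qv_neq0 // subrr expr0z.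
case: (m - n) => [[|k] // /eqP|k /eqP]; first by rewrite (negPf (q1 k)).
by rewrite NegzE -exprnN invr_eq1 (negPf (q1 k)).
Qed.

Lemma weight_entry i (n : int) v a b :
  actVV R (gK i) v = q ^ n *: v ->
  weight_exp i a + weight_exp i b != Z_of_int n -> v a b = 0.
Proof.
move=> e nab; have := congr1 (fun M : VV => M a b) e.
rewrite /actVV tensopE /actK tr_diag_mx mul_diag_mx mul_mx_diag !mxE.
rewrite mulrAC -expfzDr ?qv_neq0 // => /eqP; rewrite -subr_eq0 -mulrBl.
rewrite mulf_eq0 subr_eq0 => /orP[/eqP/qv_expz_inj ab|/eqP//].
by case/eqP: nab; rewrite -ab -!weight_expE -(rmorphD int_of_Z) int_of_ZK.
Qed.

Lemma hw_vector_top mu : mu \in VV_weights -> forall b,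
  hw_vector mu p1 b = if b == highest_letter mu then 1 else 0.
Proof.
have E (v : tensor) a b : tensor_ev v dlt a b =
    tensor_ev v (fun w => dlt w a b : K^o).
  by rewrite /tensor_ev summxE; apply: eq_bigr => t _; rewrite mxE.
have top t v b : all (fun s => nth p1 s.1 0 != p1) v ->
    nth p1 t.1 0 = p1 -> t.2 = (0, 1)%Z ->
    tensor_ev (t :: v) dlt p1 b = if b == nth p1 t.1 1 then 1 else 0.
  move=> /allP hv t1 t2; rewrite E /tensor_ev big_cons big_seq big1.
    rewrite addr0 t2 mono_ev_pos expr0z /dlt t1 mxE eqxx andTb.
    by rewrite [LHS]mul1r; case: (b == _).
  by move=> s /hv /negPf s1; rewrite /dlt mxE eq_sym s1; apply: mulr0.
rewrite !inE => /or4P[] /eqP-> b; exact: top.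
Qed.

(** Subtracting the multiple of [hw_vector mu] with the same entry at [highest_letter mu] leaves a
    zero row [p1], since the other entries of that row have the wrong weight. So the space cut out
    by the highest weight equations is a line, on which [Rmap] is a scalar. *)
Lemma hw_space_line mu v : mu \in VV_weights -> v \in hw_space R mu ->
  v = v p1 (highest_letter mu) *: hw_vector mu.
Proof.
move=> muV v_hw; apply/eqP; rewrite -subr_eq0; set u := v - _.
have /memv_hw_space u_hw : u \in hw_space R mu.
  by rewrite memvB // memvZ // hw_vector_in.
apply/eqP/hw_top_row => [i|]; first by have [] := u_hw i.
apply/rowP => b; rewrite mxE [RHS]mxE.
have /orP[/eqP->|/hasP[i _]] := all_letters (allP highest_letter_check mu muV) b.
  by rewrite 3!mxE hw_vector_top // eqxx mulr1 subrr.
have [_ uK] := u_hw i; exact: weight_entry.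
Qed.

Lemma hw_space_eigen mu : mu \in VV_weights ->
  (hw_space R mu <= passmx.leigenspace Rmap (R_eigenvalue mu))%VS.
Proof.
move=> muV; apply/subvP => v v_hw; rewrite memv_leigenspace.
rewrite (hw_space_line muV v_hw); set x := v _ _.
by rewrite linearZ /= hw_vector_eigen // !scalerA mulrC.
Qed.

(** An eigenspace of an intertwiner is a submodule, hence it contains everything generated by
    highest weight vectors lying in it. *)
Lemma Vsub_eigen mu v : mu \in VV_weights -> v \in Vsub R mu ->
  Rmap v = R_eigenvalue mu *: v.
Proof.
move=> muV vV; apply/eqP; rewrite -memv_leigenspace; apply: subvP vV.
apply: submod_gen_le (hw_space_eigen muV) => g.
apply/subvP => _ /memv_imgP[u /[!memv_leigenspace]/eqP u_eig ->].
by rewrite Rmap_actVV u_eig linearZ.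
Qed.

Definition Vsum : {vspace VV} := (\sum_(mu <- VV_weights) Vsub R mu)%VS.

Lemma Vsub_Vsum mu : mu \in VV_weights -> (Vsub R mu <= Vsum)%VS.
Proof. by move=> muV; rewrite /Vsum (big_rem mu) //= addvSl. Qed.

Lemma Vsub_act mu g v : v \in Vsub R mu -> actVV R g v \in Vsub R mu.
Proof.
rewrite /Vsub => vV; apply: (subvP (submod_gen_submod (hw_space R mu) g)).
exact: memv_img.
Qed.

Lemma memv_sum_stable (F : fieldType) (W : vectType F) (f : 'End(W))
    (I : eqType) (s : seq I) (U : I -> {vspace W}) v :
  (forall i u, i \in s -> u \in U i -> f u \in U i) ->
  v \in (\sum_(i <- s) U i)%VS -> f v \in (\sum_(i <- s) U i)%VS.
Proof.
elim: s v => [|i s IH] v fU; first by rewrite big_nil !memv0 => /eqP->; rewrite linear0.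
rewrite !big_cons => /memv_addP[u uU [w wU ->]].
rewrite linearD memv_add ?fU ?mem_head // IH // => j t js.
by apply: fU; rewrite inE js orbT.
Qed.

Lemma Vsum_act g v : v \in Vsum -> actVV R g v \in Vsum.
Proof. by apply: memv_sum_stable => mu u _; apply: Vsub_act. Qed.

Lemma lower_word_Vsum mu s : mu \in VV_weights ->
  tensor_ev (lower_word (highest_vector mu) s) dlt \in Vsum.
Proof.
move=> muV; have : tensor_ev (highest_vector mu) dlt \in Vsum.
  apply: subvP (Vsub_Vsum muV) _ _; apply: subvP (sub_submod_gen _) _ _.
  exact: hw_vector_in.
rewrite /lower_word; elim: s (highest_vector mu) => //= i s IH v vV.
by apply: IH; rewrite -actVV_tensor Vsum_act.
Qed.

Lemma bottom_Vsum : delta_mx p1 m1 \in Vsum.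
Proof.
have /andP[/allP muV /(@teqP R _ _ _ dlt)] := span_certificate_check.
rewrite tensor_ev_scale => e.
have D0 := laurent_neq0P R (isT : laurent_neq0 span_denominator).
have: tensor_ev [:: ([:: p1; m1], (0, 1)%Z)] dlt \in Vsum.
  rewrite -[tensor_ev _ _]scale1r -(mulVf D0) -scalerA e memvZ //.
  elim: span_certificate muV {e} => [_|t s IH muV]; first by rewrite tensor_ev_nil mem0v.
  rewrite tensor_ev_cat memvD // ?tensor_ev_scale ?memvZ //.
    by rewrite lower_word_Vsum // muV // mem_head.
  by apply: IH => r rs; rewrite muV // inE rs orbT.
by rewrite /tensor_ev big_seq1 mono_ev_pos expr0z scale1r.
Qed.

(* E_i v_1 = 0, so E_i (v_1 (x) v_b) = v_1 (x) E_i v_b. *)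
Lemma raise_Vsum i b b' (l := [seq t.2 | t <- E_letter i b]) :
  laurent_neq0 l && teq (act_word (gE i) [:: p1; b])
    (tscale l [:: ([:: p1; b'], (0, 1)%Z)]) ->
  delta_mx p1 b \in Vsum -> delta_mx p1 b' \in Vsum.
Proof.
move=> /andP[/(laurent_neq0P R) l0 /(@teqP R _ _ _ dlt)].
rewrite -actVV_delta tensor_ev_scale => e bV.
rewrite -[delta_mx _ _]scale1r -(mulVf l0) -scalerA memvZ //.
have -> : delta_mx p1 b' = tensor_ev [:: ([:: p1; b'], (0, 1)%Z)] dlt.
  by rewrite /tensor_ev big_seq1 mono_ev_pos expr0z scale1r.
by rewrite -e Vsum_act.
Qed.

(** In F_i (v_a (x) v_b) = F_i v_a (x) v_b + K_i^-1 v_a (x) F_i v_b the second term lies in v_a (x)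
    V, so the first one can be isolated. *)
Lemma lower_Vsum i a a' c : F_letter i a = [:: ([:: a'], (0, c)%Z)] ->
  laurent_neq0 [:: (0, c)%Z] ->
  (forall b, delta_mx a b \in Vsum) -> forall b, delta_mx a' b \in Vsum.
Proof.
move=> Fa /(laurent_neq0P R); rewrite /laurent_ev big_seq1 => c0 aV b.
have := Vsum_act (gF i) (aV b); rewrite actVV_delta /act_word [nth p1 _ 0]/=
  [nth p1 _ 1]/= tensor_ev_cat !tensor_ev_tens_letters tensor_ev_tletter Fa.
rewrite {1}/tensor_ev big_seq1 tensor_ev_tletter expr0z scale1r => h.
rewrite -[delta_mx _ _]scale1r -(mulVf c0) -scalerA memvZ //.
move: h; rewrite rpredDr //; apply: rpredZ; apply: rpred_sum => t _.
exact/rpredZ/aV.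
Qed.

(** The E_i raise the second factor of v_1 (x) v_{-1} through the whole basis; the F_i then lower
    the first factor. *)
Lemma Vsum_full : Vsum = fullv.
Proof.
have V1 : forall b, delta_mx p1 b \in Vsum.
  have b1 := bottom_Vsum.
  have b2 : delta_mx p1 m2 \in Vsum by apply: (raise_Vsum (i := ord0) _ b1); vm_compute.
  have b3 : delta_mx p1 m3 \in Vsum by apply: (raise_Vsum (i := ord_max) _ b2); vm_compute.
  have b0 : delta_mx p1 z0 \in Vsum by apply: (raise_Vsum (i := ord0) _ b3); vm_compute.
  have a3 : delta_mx p1 p3 \in Vsum by apply: (raise_Vsum (i := ord0) _ b0); vm_compute.
  have a2 : delta_mx p1 p2 \in Vsum by apply: (raise_Vsum (i := ord_max) _ a3); vm_compute.
  have a1 : delta_mx p1 p1 \in Vsum by apply: (raise_Vsum (i := ord0) _ a2); vm_compute.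
  by apply: letter_ind.
have V2 := @lower_Vsum ord0 p1 p2 1 erefl isT V1.
have V3 := @lower_Vsum ord_max p2 p3 1 erefl isT V2.
have V0 := @lower_Vsum ord0 p3 z0 1 erefl isT V3.
have W3 := @lower_Vsum ord0 z0 m3 (-1) erefl isT V0.
have W2 := @lower_Vsum ord_max m3 m2 (-1) erefl isT W3.
have W1 := @lower_Vsum ord0 m2 m1 (-1) erefl isT W2.
apply: subv_anti; rewrite subvf; apply/subvP => v _; rewrite (matrix_sum_delta v).
apply: rpred_sum => a _; apply: rpred_sum => b _; apply: rpredZ.
by elim/letter_ind: a.
Qed.

(** Write v = u + w with u in the first summand. Applying f - c_i gives (x - c_i) v, which thus lies
    in the sum of the remaining spaces and is still an eigenvector for x; by induction it is zero,
    and x - c_i cancels. *)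
Lemma eigen_sum_disjoint (F : fieldType) (W : vectType F) (f : 'End(W))
    (I : eqType) (s : seq I) (U : I -> {vspace W}) (c : I -> F) x v :
  (forall i u, i \in s -> u \in U i -> f u = c i *: u) ->
  (forall i, i \in s -> c i != x) ->
  v \in (\sum_(i <- s) U i)%VS -> f v = x *: v -> v = 0.
Proof.
elim: s v => [|i s IH] v fU cx; first by rewrite big_nil memv0 => /eqP.
rewrite big_cons => /memv_addP[u uU [w wU ev]] fv.
have sub j : j \in s -> j \in i :: s by rewrite inE orbC => ->.
have {}IH := IH _ (fun j u js => fU j u (sub j js)) (fun j js => cx j (sub j js)).
have ix : x - c i != 0 by rewrite subr_eq0 eq_sym cx ?mem_head.
have wE : f w - c i *: w = (x - c i) *: v.
  by rewrite scalerBl -fv ev [f (u + w)]linearD /= (fU i u) ?mem_head // scalerDr opprD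
    addrACA subrr add0r.
have sU : (f w - c i *: w) \in (\sum_(i <- s) U i)%VS.
  rewrite memvB ?memvZ //; apply: memv_sum_stable wU => j u' js u'U.
  by rewrite (fU j u') ?sub // memvZ.
have := IH _ sU; rewrite wE linearZ /= fv !scalerA mulrC => /(_ erefl)/eqP.
by rewrite scaler_eq0 (negPf ix) => /eqP.
Qed.

Lemma R_eigenvalue_neq mu nu : mu \in VV_weights -> nu \in VV_weights ->
  mu != nu -> R_eigenvalue mu != R_eigenvalue nu.
Proof.
have h : all (fun mu => all (fun nu => (mu != nu) ==>
    laurent_neq0 [:: R_eigen_mono mu; mono_mul (0, -1)%Z (R_eigen_mono nu)])
  VV_weights) VV_weights by vm_compute.
move=> /(allP h)/allP {}h /h/implyP {}h /h/(laurent_neq0P R).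
rewrite /laurent_ev big_cons big_seq1 mono_ev_mul mono_ev_neg expr0z mulN1r.
by rewrite subr_eq0.
Qed.

Lemma daddv_pi_eq0 (F : fieldType) (W : vectType F) (U V : {vspace W}) v :
  (U :&: V = 0)%VS -> v \in V -> daddv_pi U V v = 0.
Proof.
move=> dis vV; have disC : (V :&: U = 0)%VS by rewrite capvC.
have := daddv_pi_add dis (subvP (addvSr _ _) _ vV).
by rewrite (daddv_pi_id disC vV) => /(canRL (addrK _)); rewrite subrr.
Qed.

(** [daddv_pi] projects as intended only along a direct sum. Disjointness holds because the
    eigenvalue of [Rmap] on V_mu differs from its eigenvalues on the other constituents. *)
Lemma Pproj_Vsub mu nu v : mu \in VV_weights -> nu \in VV_weights ->
  v \in Vsub R nu -> Pproj R mu v = if nu == mu then v else 0.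
Proof.
move=> muV nuV vV; pose W := (\sum_(nu <- VV_weights | nu != mu) Vsub R nu)%VS.
have dis : (Vsub R mu :&: W = 0)%VS.
  apply/eqP; rewrite -subv0; apply/subvP => u /memv_capP[umu].
  rewrite /W -big_filter memv0 => uW; apply/eqP.
  apply: eigen_sum_disjoint uW (Vsub_eigen muV umu) => [k w|k].
    by rewrite mem_filter => /andP[_ kV]; apply: Vsub_eigen.
  by rewrite mem_filter => /andP[km kV]; apply: R_eigenvalue_neq.
rewrite /Pproj -/W; case: eqP => [e|/eqP ne].
  by apply: (daddv_pi_id dis); rewrite -e.
have vW : v \in W.
  rewrite /W (big_rem nu) // ne; exact: subvP (addvSl _ _) _ vV.
exact: daddv_pi_eq0 dis vW.
Qed.

Lemma lfun_comb4 (F : fieldType) (W : vectType F) (f1 f2 f3 f4 : 'End(W)) a b c v :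
  (a *: f1 + b *: f2 - f3 - c *: f4) v = a *: f1 v + b *: f2 v - f3 v - c *: f4 v.
Proof. by rewrite !add_lfunE !opp_lfunE !scale_lfunE. Qed.

Lemma R_eigenvalueE mu : R_eigenvalue mu =
  if mu == (4, 2) then q ^+ 2 else if mu == lambda2 then - 1
  else if mu == lambda1 then - q ^- 6 else q ^- 12.
Proof.
rewrite /R_eigenvalue /R_eigen_mono; do ?case: ifP => _.
all: by rewrite (mono_ev_pos, mono_ev_neg) ?expr0z.
Qed.

Lemma Rcheck_eigen mu v : mu \in VV_weights -> v \in Vsub R mu ->
  Rcheck R v = R_eigenvalue mu *: v.
Proof.
move=> muV vV.
have [g [-> P]] : exists g : weight -> VV,
    Rcheck R v = q ^+ 2 *: g (4, 2) + q ^- 12 *: g (0, 0) - g lambda2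
                 - q ^- 6 *: g lambda1 /\
    forall nu, nu \in VV_weights -> g nu = if mu == nu then v else 0.
  exists (fun nu => Pproj R nu v); split; first exact: lfun_comb4.
  by move=> nu nuV; apply: Pproj_Vsub vV.
rewrite !P //; rewrite R_eigenvalueE; move: muV; clear; rewrite !inE => /or4P[] /eqP->.
all: simpl (if _ then _ else _).
all: by rewrite ?(scaler0, addr0, add0r, subr0, sub0r) ?scaleNr ?scale1r.
Qed.

Lemma Rcheck_Rmap : Rcheck R = Rmap.
Proof.
apply/lfunP => v; have : v \in Vsum by rewrite Vsum_full memvf.
rewrite /Vsum; have : all (mem VV_weights) VV_weights by apply/allP.
elim: {2 3}VV_weights v => [|mu s IH] v.
  by rewrite big_nil memv0 => _ /eqP->; rewrite !linear0.
move=> /andP[muV sV]; rewrite big_cons => /memv_addP[u uV [w wV ->]].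
have -> : Rcheck R (u + w) = Rcheck R u + Rcheck R w by exact: linearD.
have -> : Rmap (u + w) = Rmap u + Rmap w by exact: linearD.
by rewrite (IH _ sV wV) (Rcheck_eigen muV uV) (Vsub_eigen muV uV).
Qed.

Section Quadratic.
Variables (F : fieldType) (W : lmodType F) (f : {linear W -> W}) (x y : F).

Definition quad (u : W) : W := f (f u) - (x + y) *: f u + (x * y) *: u.

Lemma quadD u w : quad (u + w) = quad u + quad w.
Proof.
rewrite /quad [f (u + w)]linearD [f (f u + f w)]linearD !scalerDr opprD.
by rewrite [X in X + _ = _]addrACA [LHS]addrACA.
Qed.

Lemma quad_eigen c u : f u = c *: u -> quad u = ((c - x) * (c - y)) *: u.
Proof.
move=> fu; rewrite /quad fu linearZ /= fu !scalerA -scalerBl -scalerDl.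
by congr (_ *: _); ring.
Qed.

End Quadratic.

(** The polynomial vanishes at the eigenvalues of V_{2 lambda_1} and V_0, so only the components in
    V_{lambda_2} and V_{lambda_1} survive. *)
Lemma R_quad_wedge2 v :
  quad Rmap (q ^+ 2) (q ^- 12) v \in wedge2 R.
Proof.
have fV mu u : mu \in VV_weights -> u \in Vsub R mu ->
    quad Rmap (q ^+ 2) (q ^- 12) u \in wedge2 R.
  move=> muV uV; rewrite (quad_eigen _ _ (Vsub_eigen muV uV)).
  have [/orP wmu|] := boolP ((mu == lambda2) || (mu == lambda1)).
    apply: memvZ; apply: subvP uV.
    by case: wmu => /eqP->; [exact: addvSl|exact: addvSr].
  rewrite negb_or => /andP[n2 n1]; rewrite R_eigenvalueE (negPf n1) (negPf n2).
  by case: ifP => _; rewrite subrr (mulr0, mul0r) scale0r mem0v.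
have : v \in Vsum by rewrite Vsum_full memvf.
rewrite /Vsum; have : all (mem VV_weights) VV_weights by apply/allP.
elim: {2 3}VV_weights v => [|mu s IH] v.
  rewrite big_nil memv0 => _ /eqP->.
  (* The value at 0 is obtained by regarding 0 as an eigenvector. *)
  have e0 : Rmap 0 = 0 *: 0 by rewrite linear0 scaler0.
  by rewrite (quad_eigen _ _ e0) scaler0 mem0v.
move=> /andP[muV sV]; rewrite big_cons => /memv_addP[u uV [w wV ->]].
by rewrite quadD; apply: memvD; [apply: fV uV | apply: IH].
Qed.

End RCheck.

(** * Braid and quadratic relations on letters *)

Definition R_at0 (w : seq 'I_7) : tensor :=
  [seq (nth p1 t.1 0 :: nth p1 t.1 1 :: drop 2 w, t.2) | t <- R_word w].

(** Missing letters are read as the default [p1], as in [lw] below, so that exchanges can be stated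
    for words of any length. *)
Fixpoint R_at (k : nat) (w : seq 'I_7) : tensor :=
  if k is k'.+1 then [seq (nth p1 w 0 :: t.1, t.2) | t <- R_at k' (behead w)]
  else R_at0 w.

Lemma yang_baxter_check :
  all (fun a => all (fun b => all (fun c =>
    teq (tbind (collect (tbind (R_at 1 [:: a; b; c]) (R_at 0))) (R_at 1))
        (tbind (collect (tbind (R_at 0 [:: a; b; c]) (R_at 1))) (R_at 0)))
    letters) letters) letters.
Proof. by vm_compute. Qed.

Section Braiding.
Variable R : realType.
Local Notation K := (Cq R).
Local Notation q := (@qv R).
Local Notation word := {fmonom 'I_7}.
Local Notation TV := {malg K[word]}.

Lemma tensor_ev_cons (U : lmodType K) t v (f : seq 'I_7 -> U) :
  tensor_ev (t :: v) f = mono_ev R t.2 *: f t.1 + tensor_ev v f.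
Proof. exact: big_cons. Qed.

Lemma tensor_ev_map (U : lmodType K) (h : seq 'I_7 -> seq 'I_7) v
    (f : seq 'I_7 -> U) :
  tensor_ev [seq (h t.1, t.2) | t <- v] f = tensor_ev v (fun w => f (h w)).
Proof. by rewrite /tensor_ev big_map. Qed.

Lemma entry_sum_tensor (U : lmodType K) v (F : 'I_7 -> 'I_7 -> U) :
  \sum_c \sum_d tensor_ev v (@dlt R) c d *: F c d =
  tensor_ev v (fun w => F (nth p1 w 0) (nth p1 w 1)).
Proof.
elim: v => [|t v IH].
  rewrite !tensor_ev_nil big1 // => c _; rewrite big1 // => d _.
  by rewrite mxE scale0r.
rewrite !tensor_ev_cons -IH {1 3}/dlt.
have e c : \sum_d (mono_ev R t.2 *: delta_mx (nth p1 t.1 0) (nth p1 t.1 1)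
      + tensor_ev v (@dlt R)) c d *: F c d =
    (if c == nth p1 t.1 0 then mono_ev R t.2 *: F c (nth p1 t.1 1) else 0)
    + \sum_d tensor_ev v (@dlt R) c d *: F c d.
  transitivity (row_comb (F c) (mono_ev R t.2 *:
      delta_mx (nth p1 t.1 0) (nth p1 t.1 1) + tensor_ev v (@dlt R)) c) => //.
  rewrite row_combD row_combZ row_comb_delta; case: eqP => //.
  by rewrite scaler0.
rewrite (eq_bigr _ (fun c _ => e c)) big_split /=; apply: f_equal2 => //.
by rewrite -big_mkcond big_pred1_eq.
Qed.

(** The bilinear extension of F evaluated at Rcheck (v_a (x) v_b). This is the shape in which
    [Rcheck] occurs in [braid1]; F stands for whatever happens to the two letters next, for instance
    further crossings. *)
Definition rsum (U : lmodType K) a b (F : 'I_7 -> 'I_7 -> U) : U :=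
  \sum_c \sum_d Rcoef R a b c d *: F c d.

Lemma rsumE (U : lmodType K) a b (F : 'I_7 -> 'I_7 -> U) :
  rsum a b F = tensor_ev (R_word [:: a; b]) (fun w => F (nth p1 w 0) (nth p1 w 1)).
Proof. by rewrite /rsum /Rcoef Rcheck_Rmap Rmap_delta entry_sum_tensor. Qed.

Lemma eq_rsum (U : lmodType K) a b (F G : 'I_7 -> 'I_7 -> U) :
  (forall c d, F c d = G c d) -> rsum a b F = rsum a b G.
Proof. by move=> FG; apply: eq_bigr => c _; apply: eq_bigr => d _; rewrite FG. Qed.

Lemma rsum_linear (U W : lmodType K) (h : {linear U -> W}) a b F :
  h (rsum a b F) = rsum a b (fun c d => h (F c d)).
Proof. by rewrite !rsumE tensor_ev_linear. Qed.

Lemma tensor_ev_R_at0 (U : lmodType K) w (f : seq 'I_7 -> U) :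
  tensor_ev (R_at 0 w) f =
  rsum (nth p1 w 0) (nth p1 w 1) (fun c d => f (c :: d :: drop 2 w)).
Proof.
rewrite rsumE /= /R_at0.
exact: (tensor_ev_map (fun u => nth p1 u 0 :: nth p1 u 1 :: drop 2 w)).
Qed.

Lemma tensor_ev_R_atS (U : lmodType K) k w (f : seq 'I_7 -> U) :
  tensor_ev (R_at k.+1 w) f =
  tensor_ev (R_at k (behead w)) (fun u => f (nth p1 w 0 :: u)).
Proof. exact: tensor_ev_map. Qed.

(** Letting a and b cross e and then exchanging them amounts to exchanging them before they cross
    e. *)
Lemma rsum_YB (U : lmodType K) a b e (G : 'I_7 -> 'I_7 -> 'I_7 -> U) :
  rsum b e (fun e1 b1 => rsum a e1 (fun e2 a1 => rsum a1 b1 (G e2))) =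
  rsum a b (fun c d => rsum d e (fun e1 d1 => rsum c e1 (fun e2 c1 => G e2 c1 d1))).
Proof.
pose f w := G (nth p1 w 0) (nth p1 w 1) (nth p1 w 2).
have /all_letters/(_ a)/all_letters/(_ b)/all_letters/(_ e) := yang_baxter_check.
move=> /(@teqP R _ _ _ f); rewrite !tensor_ev_bind !tensor_ev_collect.
rewrite !tensor_ev_bind tensor_ev_R_atS !tensor_ev_R_at0 => h.
transitivity (rsum b e (fun c d => tensor_ev (R_at 0 [:: a; c; d])
  (fun u => tensor_ev (R_at 1 u) f))).
  apply: eq_rsum => c d; rewrite tensor_ev_R_at0.
  by apply: eq_rsum => ? ?; rewrite tensor_ev_R_atS tensor_ev_R_at0.
apply: (etrans h); apply: eq_rsum => c d; rewrite tensor_ev_R_atS tensor_ev_R_at0.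
by apply: eq_rsum => ? ?; rewrite tensor_ev_R_at0.
Qed.

Lemma rsum_lin1 (U : lmodType K) a b x (F G : 'I_7 -> 'I_7 -> U) :
  rsum a b (fun c d => x *: F c d + G c d) = x *: rsum a b F + rsum a b G.
Proof.
rewrite !rsumE /tensor_ev scaler_sumr -big_split /=; apply: eq_bigr => t _.
by rewrite scalerDr !scalerA mulrC.
Qed.

Lemma rsum_lin (U : lmodType K) a b x y z (F G H : 'I_7 -> 'I_7 -> U) :
  rsum a b (fun c d => x *: F c d + y *: G c d + z *: H c d) =
  x *: rsum a b F + y *: rsum a b G + z *: rsum a b H.
Proof.
rewrite !rsumE /tensor_ev !scaler_sumr -!big_split /=; apply: eq_bigr => t _.
by rewrite !scalerDr !scalerA ![_ * mono_ev _ _]mulrC.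
Qed.

(* The relations X_a X_b |-> (Rcheck - q^2) (Rcheck - q^-12), which span
   \wedge_q^2 V. *)
Definition rquad (U : lmodType K) a b (F : 'I_7 -> 'I_7 -> U) : U :=
  1 *: rsum a b (fun c d => rsum c d F) + (- (q ^+ 2 + q ^- 12)) *: rsum a b F
  + (q ^+ 2 * q ^- 12) *: F a b.

Lemma rsum_rsum (U : lmodType K) a b c d (F : 'I_7 -> 'I_7 -> 'I_7 -> 'I_7 -> U) :
  rsum a b (fun x y => rsum c d (F x y)) =
  rsum c d (fun z t => rsum a b (fun x y => F x y z t)).
Proof.
rewrite rsumE [RHS]rsumE /tensor_ev.
under eq_bigr => s _ do rewrite rsumE /tensor_ev scaler_sumr.
rewrite exchange_big; apply: eq_bigr => s _ /=.
rewrite rsumE /tensor_ev scaler_sumr; apply: eq_bigr => t _.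
by rewrite !scalerA mulrC.
Qed.

Lemma rsum_rquad (U : lmodType K) a b c d (F : 'I_7 -> 'I_7 -> 'I_7 -> 'I_7 -> U) :
  rsum a b (fun x y => rquad c d (F x y)) =
  rquad c d (fun z t => rsum a b (fun x y => F x y z t)).
Proof.
rewrite /rquad rsum_lin (rsum_rsum a b c d F).
rewrite (rsum_rsum a b c d (fun x y z t => rsum z t (F x y))).
by rewrite (@eq_rsum _ c d _ _ (fun z t => rsum_rsum a b z t F)).
Qed.

Lemma rquad_lin1 (U : lmodType K) a b x (F G : 'I_7 -> 'I_7 -> U) :
  rquad a b (fun c d => x *: F c d + G c d) = x *: rquad a b F + rquad a b G.
Proof.
have D c d : rsum c d (fun e f => x *: F e f + G e f) = x *: rsum c d F + rsum c d G.
  exact: rsum_lin1.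
rewrite /rquad D (@eq_rsum _ a b _ _ D) rsum_lin1 !scalerDr !scalerA.
by rewrite ![x * _]mulrC [X in X + _ = _]addrACA [LHS]addrACA.
Qed.

Lemma eq_rquad (U : lmodType K) a b (F G : 'I_7 -> 'I_7 -> U) :
  (forall c d, F c d = G c d) -> rquad a b F = rquad a b G.
Proof.
move=> FG; rewrite /rquad FG (@eq_rsum _ a b _ _ FG).
by rewrite (@eq_rsum _ a b _ _ (fun c d => @eq_rsum _ c d _ _ FG)).
Qed.

Lemma rquad_linear (U W : lmodType K) (h : {linear U -> W}) a b F :
  h (rquad a b F) = rquad a b (fun c d => h (F c d)).
Proof.
rewrite /rquad !linearD !linearZ /= !(rsum_linear h).
by rewrite (@eq_rsum _ a b _ _ (fun c d => rsum_linear h c d F)).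
Qed.

End Braiding.

(** * Left multiplication by letters *)

Section LinearExtension.
Variable R : realType.
Local Notation K := (Cq R).

Section Mext.
Variables (B : choiceType) (U : lmodType K).
Implicit Types (f g : B -> U) (x : {malg K[B]}).

Lemma mextEw f x (d : {fset B}) : (msupp x `<=` d)%fset ->
  mext f x = \sum_(k <- d) x@_k *: f k.
Proof.
move=> xd; rewrite /mext (big_fset_incl _ xd) // => k _ /mcoeff_outdom->.
by rewrite scale0r.
Qed.

Lemma mext_is_linear f : linear (mext f).
Proof.
move=> c x y; pose d := (msupp x `|` msupp y)%fset.
have xd : (msupp x `<=` d)%fset by apply: fsubsetUl.
have yd : (msupp y `<=` d)%fset by apply: fsubsetUr.
have zd : (msupp (c *: x + y) `<=` d)%fset.
  apply: fsubset_trans (msuppD_le _ _) _; apply: fsetSU; exact: msuppZ_le.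
rewrite (mextEw f xd) (mextEw f yd) (mextEw f zd) scaler_sumr -big_split.
by apply: eq_bigr => k _; rewrite mcoeffD mcoeffZ scalerDl scalerA.
Qed.

HB.instance Definition _ f :=
  GRing.isLinear.Build K {malg K[B]} U _ (mext f) (mext_is_linear f).

Lemma mextU f k : mext f << k >> = f k.
Proof. by rewrite (mextEw f msuppU_le) big_seq_fset1 mcoeffUU scale1r. Qed.

Lemma eq_mext_in f g x : {in msupp x, f =1 g} -> mext f x = mext g x.
Proof. by move=> fg; apply: eq_big_seq => k /fg->. Qed.

Lemma eq_mext f g x : f =1 g -> mext f x = mext g x.
Proof. by move=> fg; apply: eq_mext_in => k _. Qed.

Lemma mextD f g x : mext (fun k => f k + g k) x = mext f x + mext g x.
Proof. by rewrite -big_split; apply: eq_bigr => k _; rewrite scalerDr. Qed.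

Lemma mextZ c f x : mext (fun k => c *: f k) x = c *: mext f x.
Proof.
by rewrite scaler_sumr; apply: eq_bigr => k _; rewrite !scalerA mulrC.
Qed.

Lemma mext_rsum a b (f : B -> 'I_7 -> 'I_7 -> U) x :
  mext (fun k => rsum a b (f k)) x = rsum a b (fun c d => mext (fun k => f k c d) x).
Proof.
rewrite rsumE /tensor_ev; under eq_mext => k do rewrite rsumE.
rewrite /mext /tensor_ev; under eq_bigr => k _ do rewrite scaler_sumr.
rewrite exchange_big; apply: eq_bigr => t _; rewrite scaler_sumr.
by apply: eq_bigr => k _; rewrite !scalerA mulrC.
Qed.

Lemma mext_rquad a b (f : B -> 'I_7 -> 'I_7 -> U) x :
  mext (fun k => rquad a b (f k)) x = rquad a b (fun c d => mext (fun k => f k c d) x).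
Proof.
rewrite /rquad !mextD !mextZ !mext_rsum.
by rewrite (@eq_rsum _ _ a b _ _ (fun c d => mext_rsum c d f x)).
Qed.

End Mext.

Lemma mext_comp (B : choiceType) (U W : lmodType K) (h : {linear U -> W})
    (f : B -> U) x : h (mext f x) = mext (fun k => h (f k)) x.
Proof. by rewrite linear_sum; apply: eq_bigr => k _; rewrite linearZ. Qed.

Lemma mext_mext (B C : choiceType) (U : lmodType K) (g : C -> U)
    (f : B -> {malg K[C]}) x : mext g (mext f x) = mext (fun k => mext g (f k)) x.
Proof. exact: mext_comp. Qed.

Lemma mext_exchange (B C : choiceType) (U : lmodType K) (f : B -> C -> U) x y :
  mext (fun k => mext (f k) y) x = mext (fun l => mext (f^~ l) x) y.
Proof.
rewrite /mext; under eq_bigr => k _ do rewrite scaler_sumr.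
rewrite exchange_big; apply: eq_bigr => l _; rewrite scaler_sumr.
by apply: eq_bigr => k _; rewrite !scalerA mulrC.
Qed.

Lemma malgU_scale (B : choiceType) c (k : B) : << c *g k >> = c *: << k >> :> {malg K[B]}.
Proof. by apply/malgP => l; rewrite mcoeffZ !mcoeffU mulr_natr. Qed.

Lemma linear_mext (B : choiceType) (U : lmodType K)
    (h : {linear {malg K[B]} -> U}) x : h x = mext (fun k => h << k >>) x.
Proof.
rewrite [in LHS](monalgE x) linear_sum; apply: eq_bigr => k _.
by rewrite -linearZ malgU_scale.
Qed.

Lemma linear_eq_mext (B : choiceType) (U : lmodType K) (f : {malg K[B]} -> U) x :
  linear f -> f x = mext (fun k => f << k >>) x.
Proof.
move=> fP; pose fL := GRing.isLinear.Build K {malg K[B]} U _ f fP.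
pose f' : {linear {malg K[B]} -> U} := HB.pack f fL.
exact: (linear_mext f').
Qed.

(** Used to carry a property of tuples, the emptiness of their first slots, through the sums
    produced by the braiding. *)
Definition supported (B : choiceType) (P : B -> Prop) (x : {malg K[B]}) :=
  forall k, k \in msupp x -> P k.

Lemma supportedU (B : choiceType) (P : B -> Prop) k : P k -> supported P << k >>.
Proof. by move=> Pk l /(fsubsetP msuppU_le); rewrite inE => /eqP->. Qed.

Lemma supported_mext (B C : choiceType) (P : C -> Prop) (f : B -> {malg K[C]}) x :
  (forall k, k \in msupp x -> supported P (f k)) -> supported P (mext f x).
Proof.
move=> h k; rewrite -mcoeff_neq0 /mext raddf_sum /= big_seq => kx.
have [l lx fl] : exists2 l, l \in msupp x & (f l)@_k != 0.
  apply/hasP; apply: contraNT kx => /hasPn h0; apply/eqP/big1 => l lx.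
  by rewrite mcoeffZ; have /negPn/eqP-> := h0 l lx; rewrite mulr0.
have hl : supported P (f l) := h l lx.
by apply: hl; rewrite -mcoeff_neq0.
Qed.

End LinearExtension.

(** * Letters crossing words *)

Section Words.
Variable R : realType.
Local Notation K := (Cq R).
Local Notation q := (@qv R).
Local Notation word := {fmonom 'I_7}.

Lemma word_cons a (w : word) : mmul (fmu a) w = a :: w :> seq 'I_7.
Proof. by rewrite /mmul /= fmmulE /= fmuE. Qed.

Lemma word_cat (u w : word) : mmul u w = u ++ w :> seq 'I_7.
Proof. by rewrite /mmul /= fmmulE. Qed.

(* The letter a crosses the word w. *)
Definition push1 (U : lmodType K) a (w : seq 'I_7) (F : word -> 'I_7 -> U) : U :=
  mext (fun p => F p.1 p.2) (braid1 R a w).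

Lemma push1_nil (U : lmodType K) a (F : word -> 'I_7 -> U) :
  push1 a [::] F = F mone a.
Proof. exact: mextU. Qed.

Lemma push1_cons (U : lmodType K) a b w (F : word -> 'I_7 -> U) :
  push1 a (b :: w) F =
  rsum a b (fun c d => push1 d w (fun u e => F (mmul (fmu c) u) e)).
Proof.
rewrite /push1 /= -/(rsum a b (fun c d =>
  mext (fun p => << (mmul (fmu c) p.1, p.2) >>) (braid1 R d w))).
rewrite rsum_linear; apply: eq_rsum => c d.
by rewrite /= mext_mext; apply: eq_mext => p; rewrite mextU.
Qed.

Lemma eq_push1 (U : lmodType K) a w (F G : word -> 'I_7 -> U) :
  (forall u b, F u b = G u b) -> push1 a w F = push1 a w G.
Proof. by move=> FG; apply: eq_mext => p; apply: FG. Qed.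

Lemma push1_rsum (U : lmodType K) a w x y (F : word -> 'I_7 -> 'I_7 -> 'I_7 -> U) :
  push1 a w (fun u e => rsum x y (F u e)) =
  rsum x y (fun c d => push1 a w (fun u e => F u e c d)).
Proof. exact: (mext_rsum x y (fun p => F p.1 p.2)). Qed.

Lemma push1_rquad (U : lmodType K) a w x y (F : word -> 'I_7 -> 'I_7 -> 'I_7 -> U) :
  push1 a w (fun u e => rquad x y (F u e)) =
  rquad x y (fun c d => push1 a w (fun u e => F u e c d)).
Proof. exact: (mext_rquad x y (fun p => F p.1 p.2)). Qed.

Lemma push1_linear (U W : lmodType K) (h : {linear U -> W}) a w
    (F : word -> 'I_7 -> U) : h (push1 a w F) = push1 a w (fun u b => h (F u b)).
Proof. exact: mext_comp. Qed.

Definition push2 (U : lmodType K) a b (w : seq 'I_7)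
    (F : word -> 'I_7 -> 'I_7 -> U) : U :=
  push1 b w (fun u d => push1 a u (fun v c => F v c d)).

Lemma push2_nil (U : lmodType K) a b (F : word -> 'I_7 -> 'I_7 -> U) :
  push2 a b [::] F = F mone a b.
Proof. by rewrite /push2 push1_nil fm1 push1_nil. Qed.

Lemma push2_cons (U : lmodType K) a b e w (F : word -> 'I_7 -> 'I_7 -> U) :
  push2 a b (e :: w) F =
  rsum b e (fun e1 b1 => rsum a e1 (fun e2 a1 =>
    push2 a1 b1 w (fun u => F (mmul (fmu e2) u)))).
Proof.
rewrite /push2 push1_cons; apply: eq_rsum => e1 b1.
rewrite -(push1_rsum b1 w a e1 (fun u d e2 a1 =>
  push1 a1 u (fun v c => F (mmul (fmu e2) v) c d))).
by apply: eq_push1 => u d; rewrite word_cons push1_cons.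
Qed.

Lemma eq_push2 (U : lmodType K) a b w (F G : word -> 'I_7 -> 'I_7 -> U) :
  (forall u c d, F u c d = G u c d) -> push2 a b w F = push2 a b w G.
Proof. by move=> FG; apply: eq_push1 => u d; apply: eq_push1 => v c. Qed.

(** [rsum_YB] moves the exchange of the two letters across w one letter at a time. *)
Lemma push2_rsum (U : lmodType K) a b w (F : word -> 'I_7 -> 'I_7 -> U) :
  push2 a b w (fun u c d => rsum c d (F u)) = rsum a b (fun c d => push2 c d w F).
Proof.
elim: w a b F => [|e w IH] a b F.
  by rewrite push2_nil; apply: eq_rsum => c d; rewrite push2_nil.
rewrite push2_cons.
under eq_rsum => e1 b1 do under eq_rsum => e2 a1 do rewrite IH.
rewrite (rsum_YB a b e (fun e2 c d => push2 c d w (fun u => F (mmul (fmu e2) u)))).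
by apply: eq_rsum => c d; rewrite push2_cons.
Qed.

Lemma push2_rquad (U : lmodType K) a b w (F : word -> 'I_7 -> 'I_7 -> U) :
  push2 a b w (fun u c d => rquad c d (F u)) = rquad a b (fun c d => push2 c d w F).
Proof.
have lin x y z (F1 F2 F3 : word -> 'I_7 -> 'I_7 -> U) :
    push2 a b w (fun u c d => x *: F1 u c d + y *: F2 u c d + z *: F3 u c d) =
    x *: push2 a b w F1 + y *: push2 a b w F2 + z *: push2 a b w F3.
  rewrite /push2 /push1 -!mextZ -!mextD; apply: eq_mext => p.
  by rewrite -!mextZ -!mextD.
rewrite [LHS]lin /rquad !push2_rsum.
by rewrite (@eq_rsum _ _ a b _ _ (fun c d => push2_rsum c d w F)).
Qed.

Section RquadPast.
Variables (U : lmodType K) (a : 'I_7) (G : 'I_7 -> 'I_7 -> 'I_7 -> U).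

(** Mirror image of [push2] on one letter: here a single letter a crosses a pair, and the
    Yang-Baxter equation moves an exchange within the crossed pair. *)
Definition past2 b c (F : 'I_7 -> 'I_7 -> 'I_7 -> U) : U :=
  rsum a b (fun b1 a1 => rsum a1 c (fun c1 a2 => F b1 c1 a2)).

Lemma rsum_past2 b c F :
  rsum b c (fun b1 c1 => past2 b1 c1 F) =
  past2 b c (fun b1 c1 e => rsum b1 c1 (fun b2 c2 => F b2 c2 e)).
Proof. exact: (rsum_YB a b c F). Qed.

Lemma rquad_past2 b c :
  rquad b c (fun b1 c1 => past2 b1 c1 G) =
  past2 b c (fun b1 c1 e => rquad b1 c1 (fun b2 c2 => G b2 c2 e)).
Proof.
have lin x y z F1 F2 F3 :
    past2 b c (fun b1 c1 e => x *: F1 b1 c1 e + y *: F2 b1 c1 e + z *: F3 b1 c1 e) =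
    x *: past2 b c F1 + y *: past2 b c F2 + z *: past2 b c F3.
  rewrite /past2 -rsum_lin; apply: eq_rsum => b1 a1; exact: rsum_lin.
rewrite [RHS]lin /rquad -!rsum_past2.
by rewrite -(@eq_rsum _ _ b c _ _ (fun b1 c1 => rsum_past2 b1 c1 G)).
Qed.

End RquadPast.

End Words.

(** * The braided product through left multiplication *)

Section BraidedProduct.
Variable R : realType.
Local Notation K := (Cq R).
Local Notation q := (@qv R).
Local Notation word := {fmonom 'I_7}.
Local Notation TV := {malg K[word]}.
Local Notation Tm := (Tm R).

Definition consT m (w : word) (z : Tm m) : Tm m.+1 :=
  mext (fun t : m.-tuple word => << [tuple of w :: t] >> : Tm m.+1) z.

HB.instance Definition _ m w := GRing.Linear.copy (@consT m w)
  (mext (fun t : m.-tuple word => << [tuple of w :: t] >> : Tm m.+1)).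

Lemma consTU m w (t : m.-tuple word) :
  consT w << t >> = << [tuple of w :: t] >> :> Tm m.+1.
Proof. exact: mextU. Qed.

(* Left multiplication by X_{ia} on T(V)^{(x) m} (see bmulX below): the letter
   a crosses the first i factors. *)
Fixpoint lamT m (i : nat) (a : 'I_7) : m.-tuple word -> Tm m :=
  match m with
  | 0 => fun _ => 0
  | m'.+1 => fun x =>
      if i is i'.+1 then
        push1 a (thead x) (fun u b => consT u (lamT i' b [tuple of behead x]))
      else << [tuple of mmul (fmu a) (thead x) :: behead x] >>
  end.

Definition lam m i a (z : Tm m) : Tm m := mext (@lamT m i a) z.

HB.instance Definition _ m i a := GRing.Linear.copy (@lam m i a) (mext (@lamT m i a)).

Lemma behead_cons m (w : word) (t : m.-tuple word) :
  [tuple of behead [tuple of w :: t]] = t.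
Proof. exact: val_inj. Qed.

Lemma lam0_cons m a w (z : Tm m) :
  lam 0 a (consT w z) = consT (mmul (fmu a) w) z.
Proof.
rewrite /lam /consT mext_mext; apply: eq_mext => t; rewrite mextU /= theadE.
by congr << _ >>; apply: val_inj.
Qed.

Lemma lamS_cons m i a w (z : Tm m) :
  lam i.+1 a (consT w z) = push1 a w (fun u b => consT u (lam i b z)).
Proof.
have e (t : m.-tuple word) : lamT i.+1 a [tuple of w :: t] =
      push1 a w (fun u b => consT u (lamT i b t)).
    by rewrite /= theadE behead_cons.
transitivity (mext (fun t => push1 a w (fun u b => consT u (lamT i b t))) z).
  by rewrite /lam /consT mext_mext; apply: eq_mext => t; rewrite mextU e.
rewrite [LHS]mext_exchange; apply: eq_mext => p.
by rewrite /lam mext_comp.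
Qed.

Lemma lam_lin m i a c (x y : Tm m) :
  lam i a (c *: x + y) = c *: lam i a x + lam i a y.
Proof. exact: linearP. Qed.

Lemma lam_push1 m i a b w (F : word -> 'I_7 -> Tm m) :
  lam i a (push1 b w F) = push1 b w (fun u c => lam i a (F u c)).
Proof. exact: push1_linear. Qed.

Lemma consT_rsum m w b c (F : 'I_7 -> 'I_7 -> Tm m) :
  consT w (rsum b c F) = rsum b c (fun d e => consT w (F d e)).
Proof. exact: rsum_linear. Qed.

Lemma linear_eq_cons m (U : lmodType K) (f g : Tm m.+1 -> U) :
  linear f -> linear g -> (forall w z, f (consT w z) = g (consT w z)) -> f =1 g.
Proof.
move=> fP gP fg z.
have fE := @linear_eq_mext R (m.+1.-tuple word) U f z fP.
have gE := @linear_eq_mext R (m.+1.-tuple word) U g z gP.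
rewrite fE gE; apply: eq_mext => x.
by case/tupleP: x => w t; rewrite -consTU; apply: fg.
Qed.

(** If i = 0, the letter for slot j first meets b at the head of the first factor, and this crossing
    is the exchange. If i > 0, both letters cross the first factor, and [push2_rsum] lets the
    exchange take place beyond it, among fewer factors. *)
Lemma lam_exchange m i j a b (z : Tm m) : (i < j)%N ->
  lam j a (lam i b z) = rsum a b (fun c d => lam i c (lam j d z)).
Proof.
elim: m i j a b z => [|m IH] i j a b z ltij.
  have l0 k e (y : Tm 0) : lam k e y = 0.
    by rewrite /lam /mext big1 // => t _; rewrite scaler0.
  by rewrite !l0 rsumE /tensor_ev big1 // => t _; rewrite l0 scaler0.
apply: (linear_eq_cons (f := fun z => lam j a (lam i b z))
  (g := fun z => rsum a b (fun c d => lam i c (lam j d z)))) => [c x y|c x y|w {}z].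
  by rewrite !lam_lin.
  transitivity (rsum a b (fun e f => c *: lam i e (lam j f x) + lam i e (lam j f y))).
    by apply: eq_rsum => e f; rewrite !lam_lin.
  exact: rsum_lin1.
case: j ltij => // j; case: i => [_|i ltij].
  rewrite lam0_cons lamS_cons word_cons push1_cons.
  apply: eq_rsum => c d; rewrite lamS_cons lam_push1.
  by apply: eq_push1 => u e; rewrite lam0_cons.
have e c d k l : lam k.+1 c (lam l.+1 d (consT w z)) =
    push2 c d w (fun u c' d' => consT u (lam k c' (lam l d' z))).
  rewrite lamS_cons lam_push1; apply: eq_push1 => u d'.
  by rewrite lamS_cons.
rewrite e; transitivity (rsum a b (fun c d =>
  push2 c d w (fun u c' d' => consT u (lam i c' (lam j d' z))))); last first.
  by apply: eq_rsum => c d; rewrite e.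
rewrite -push2_rsum; apply: eq_push2 => u c d; rewrite IH //.
by rewrite consT_rsum.
Qed.

Definition emptyT m i (x : m.-tuple word) := all (pred1 (mone : word)) (take i x).

(** Insertion of a at the front of factor i without any crossing; [lamT] does the same when the
    factors before i are empty. *)
Fixpoint pushT m (i : nat) (a : 'I_7) : m.-tuple word -> m.-tuple word :=
  match m with
  | 0 => fun x => x
  | m'.+1 => fun x =>
      if i is i'.+1 then [tuple of thead x :: pushT i' a [tuple of behead x]]
      else [tuple of mmul (fmu a) (thead x) :: behead x]
  end.

Definition oneT m : m.-tuple word := [tuple of nseq m (mone : word)].

Lemma oneT_cons m : oneT m.+1 = [tuple of (mone : word) :: oneT m].
Proof. exact: val_inj. Qed.

Lemma pushT0_cons m a w (t : m.-tuple word) :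
  pushT 0 a [tuple of w :: t] = [tuple of mmul (fmu a) w :: t].
Proof. by apply: val_inj; rewrite /= theadE. Qed.

Lemma pushTS_cons m i a w (t : m.-tuple word) :
  pushT i.+1 a [tuple of w :: t] = [tuple of w :: pushT i a t].
Proof. by apply: val_inj; rewrite /= theadE behead_cons. Qed.

Lemma tnth_pushT m i a (x : m.-tuple word) (s : 'I_m) :
  tnth (pushT i a x) s = if s == i :> nat then mmul (fmu a) (tnth x s) else tnth x s.
Proof.
elim: m i x s => [|m IH] i x s; first by case: s.
case/tupleP: x => w t; case: (unliftP ord0 s) => [j ->|->].
  case: i => [|i]; first by rewrite pushT0_cons !tnthS.
  by rewrite pushTS_cons !tnthS IH.
by case: i => [|i]; rewrite ?pushT0_cons ?pushTS_cons !tnth0.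
Qed.

Lemma X_push m (i : 'I_m) a : X i a = << pushT i a (oneT m) >> :> Tm m.
Proof.
congr << _ >>; apply: eq_from_tnth => s; rewrite tnth_pushT !tnth_mktuple.
rewrite /oneT (tnth_nth mone) nth_nseq ltn_ord mulm1.
by rewrite -(inj_eq val_inj).
Qed.

Lemma emptyT_cons m i w (t : m.-tuple word) :
  emptyT i.+1 [tuple of w :: t] = (w == mone) && emptyT i t.
Proof. by []. Qed.

Lemma lamT_push m i a (x : m.-tuple word) : (i < m)%N -> emptyT i x ->
  lamT i a x = << pushT i a x >>.
Proof.
elim: m i x => [|m IH] [|i] x //; case/tupleP: x => w t lti.
rewrite emptyT_cons => /andP[/eqP-> et]; rewrite pushTS_cons /=.
rewrite theadE behead_cons fm1 push1_nil IH //; exact: consTU.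
Qed.

Lemma emptyT_push m i j a (x : m.-tuple word) : (i <= j)%N ->
  emptyT i x -> emptyT i (pushT j a x).
Proof.
elim: m i j x => [|m IH] [|i] [|j] x //.
case/tupleP: x => w t lij; rewrite pushTS_cons !emptyT_cons => /andP[-> /=].
exact: IH.
Qed.

Lemma emptyT_one m i : emptyT i (oneT m).
Proof.
by apply/allP => w /mem_take /nseqP[->]; rewrite inE.
Qed.

Lemma braid_nil u : braid R [::] u = << (u, mone) >>.
Proof. by []. Qed.

Lemma mext_push1 (B : choiceType) (U : lmodType K) (g : B -> U) a w
    (F : word -> 'I_7 -> {malg K[B]}) :
  mext g (push1 a w F) = push1 a w (fun u b => mext g (F u b)).
Proof. exact: mext_mext. Qed.

Lemma braid_tuple_cons m w (t : m.-tuple word) u :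
  braid_tuple R [tuple of w :: t] u =
  mext (fun p : word * m.-tuple word =>
      mext (fun r : word * word => << (r.1, [tuple of r.2 :: p.2]) >>) (braid R w p.1))
    (braid_tuple R t u).
Proof. by rewrite /= theadE behead_cons. Qed.

Lemma mul_tuple_cons m w (t : m.-tuple word) u (s : m.-tuple word) :
  mul_tuple R [tuple of w :: t] [tuple of u :: s] =
  mext (fun p : word * m.-tuple word => consT (mmul w p.1) (mul_tuple R p.2 s))
    (braid_tuple R t u).
Proof. by rewrite /= !theadE !behead_cons. Qed.

Lemma braid_tuple_empty m i (x : m.-tuple word) u : emptyT i x ->
  supported (fun p => emptyT i p.2) (braid_tuple R x u).
Proof.
elim: m i x u => [|m IH] i x u.
  by move=> _; apply: supportedU; rewrite /emptyT; case: i.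
case/tupleP: x => w t; case: i => [|i]; first by move=> _ k _; rewrite /emptyT take0.
rewrite emptyT_cons => /andP[/eqP-> et]; rewrite braid_tuple_cons.
apply: supported_mext => p /(IH i t u et) ep.
by rewrite fm1 braid_nil mextU; apply: supportedU; rewrite emptyT_cons eqxx.
Qed.

Lemma braid_tuple_one m u : braid_tuple R (oneT m) u = << (u, oneT m) >>.
Proof.
elim: m => [|m IH]; first by congr << (_, _) >>; apply: val_inj.
by rewrite oneT_cons braid_tuple_cons IH mextU fm1 braid_nil mextU.
Qed.

Lemma mul_tuple_one m (t : m.-tuple word) : mul_tuple R (oneT m) t = << t >>.
Proof.
elim: m t => [|m IH] t; first by rewrite (tuple0 t); congr << _ >>; apply: val_inj.
case/tupleP: t => u s; rewrite oneT_cons mul_tuple_cons braid_tuple_one mextU.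
by rewrite IH mul1m; exact: consTU.
Qed.

Lemma braid_tuple_push m i a (x : m.-tuple word) u : (i < m)%N -> emptyT i x ->
  braid_tuple R (pushT i a x) u =
  mext (fun p : word * m.-tuple word => push1 a p.1 (fun v b => << (v, pushT i b p.2) >>))
    (braid_tuple R x u).
Proof.
elim: m i x u => [|m IH] [|i] x u //; case/tupleP: x => w t lti.
  move=> _; rewrite pushT0_cons !braid_tuple_cons mext_mext; apply: eq_mext => p.
  rewrite word_cons /= !mext_mext; apply: eq_mext => r; rewrite mextU /= mext_mext.
  apply: eq_mext => s; rewrite mextU /=.
  by rewrite theadE; congr << (_, _) >>; apply: val_inj.
rewrite emptyT_cons => /andP[/eqP-> et]; rewrite pushTS_cons !braid_tuple_cons.
rewrite (IH i t u lti et) mext_mext.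
rewrite mext_mext; apply: eq_mext => p.
rewrite mext_push1 fm1 braid_nil [in RHS]mext_mext [RHS]mextU [RHS]mextU.
by apply: eq_push1 => v b; rewrite mextU braid_nil mextU pushTS_cons.
Qed.

(** An instance of associativity, (X_{ia} x) y = X_{ia} (x y). The factors of x before slot i are
    empty, so the inserted letter is the leftmost one and crosses the factors of y after all letters
    of x. *)
Lemma mul_push m i a (x y : m.-tuple word) : (i < m)%N -> emptyT i x ->
  mul_tuple R (pushT i a x) y = lam i a (mul_tuple R x y).
Proof.
elim: m i a x y => [|m IH] [|i] a x y //; case/tupleP: x => w t.
  case/tupleP: y => u s _ _; rewrite pushT0_cons !mul_tuple_cons.
  rewrite [RHS]mext_comp; apply: eq_mext => p.
  by rewrite [RHS]lam0_cons mulmA.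
case/tupleP: y => u s lti; rewrite emptyT_cons => /andP[/eqP-> et].
rewrite pushTS_cons !mul_tuple_cons.
rewrite (@braid_tuple_push m i a t u lti et) mext_mext.
rewrite [RHS]mext_comp; apply: eq_mext_in => p /(braid_tuple_empty et) ep.
rewrite mul1m [RHS]lamS_cons /push1 mext_mext; apply: eq_mext => r.
by rewrite mextU /= mul1m (IH i r.2 p.2 s lti ep).
Qed.

Lemma bmulX m (i : 'I_m) a (y : Tm m) : X i a ** y = lam i a y.
Proof.
rewrite /bmul X_push mextU; apply: eq_mext => t.
rewrite mul_push ?emptyT_one // mul_tuple_one; exact: mextU.
Qed.

Definition unitT m : Tm m := << oneT m >>.

Lemma X_lam m (i : 'I_m) a : X i a = lam i a (unitT m).
Proof. by rewrite X_push /lam mextU lamT_push ?emptyT_one. Qed.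

End BraidedProduct.

Section Products.
Variable R : realType.
Local Notation K := (Cq R).
Local Notation q := (@qv R).
Local Notation word := {fmonom 'I_7}.
Local Notation TV := {malg K[word]}.
Local Notation Tm := (Tm R).
Local Notation unitT := (unitT R).

Lemma bmul_push m i a (x : m.-tuple word) (y : Tm m) : (i < m)%N -> emptyT i x ->
  << pushT i a x >> ** y = lam i a ((<< x >> : Tm m) ** y).
Proof.
move=> lti ex; rewrite /bmul !mextU [RHS]mext_comp; apply: eq_mext => t.
exact: mul_push.
Qed.

Lemma bmul_one m (y : Tm m) : unitT m ** y = y.
Proof.
rewrite /bmul mextU; transitivity (mext (fun t : m.-tuple word => << t >> : Tm m) y).
  by apply: eq_mext => t; rewrite mul_tuple_one.
by rewrite -(@linear_eq_mext R (m.-tuple word) (Tm m) id y).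
Qed.

(* Left multiplication by X_{s_1 w_1} X_{s_2 w_2} ... *)
Fixpoint lw m (s : seq nat) (w : seq 'I_7) (z : Tm m) : Tm m :=
  if s is i :: s' then lam i (nth p1 w 0) (lw s' (behead w) z) else z.

(** Letters multiplied in sorted order, the last one first, find only empty factors on their left;
    the product is therefore one pure tensor, and [bmul_push] applies at each letter. The default in
    [head m s] says that all m factors of the unit are empty. *)
Lemma lw_one_sorted m s w : all (fun i => (i < m)%N) s -> sorted leq s ->
  exists2 x : m.-tuple word, lw s w (unitT m) = << x >> &
    emptyT (head m s) x /\ forall y, (<< x >> : Tm m) ** y = lw s w y.
Proof.
elim: s w => [|i s IH] w /=.
  move=> _ _; exists (oneT m); split; first exact: emptyT_one.
  exact: bmul_one.
move=> /andP[lti ltm] srt; have [x xE [ex xM]] := IH (behead w) ltm (path_sorted srt).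
have {}ex : emptyT i x.
  case: s srt ltm ex {IH xE xM} => [|j s] /=; last first.
    move=> /andP[lij _] _ /allP ex; apply/allP => u.
    by rewrite -(take_takel x lij) => /mem_take/ex.
  move=> _ _ /allP ex; apply/allP => u /mem_take ux; apply: ex.
  by rewrite take_oversize ?size_tuple.
exists (pushT i (nth p1 w 0) x).
  by rewrite xE /lam mextU lamT_push.
split=> [|y]; last by rewrite (bmul_push _ y lti ex) xM.
exact: emptyT_push.
Qed.

Lemma bmul_lw m s w (y : Tm m) : all (fun i => (i < m)%N) s -> sorted leq s ->
  lw s w (unitT m) ** y = lw s w y.
Proof. by move=> lts srt; have [x -> [_ ->]] := lw_one_sorted w lts srt. Qed.

Lemma bmul_rsum m a b (F : 'I_7 -> 'I_7 -> Tm m) y :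
  rsum a b F ** y = rsum a b (fun c d => F c d ** y).
Proof. exact: (rsum_linear (mext (fun s => mext (mul_tuple R s) y)) a b F). Qed.

(** For i > j one exchange gives a combination of sorted products; this covers Phi^{(i,j)} with i >
    j. *)
Lemma bmul_lw2 m i j w (y : Tm m) : (i < m)%N -> (j < m)%N ->
  lw [:: i; j] w (unitT m) ** y = lw [:: i; j] w y.
Proof.
move=> lti ltj; have [lij|ltji] := leqP i j.
  by apply: bmul_lw; rewrite /= ?lti ?ltj ?lij.
have ex z : lw [:: i; j] w z =
    rsum (nth p1 w 0) (nth p1 (behead w) 0) (fun c d => lw [:: j; i] [:: c; d] z).
  exact: lam_exchange.
rewrite [in LHS]ex bmul_rsum [RHS]ex; apply: eq_rsum => c d.
by apply: bmul_lw; rewrite /= ?lti ?ltj // andbT ltnW.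
Qed.

Lemma XX_lw m (i j : 'I_m) a b : X i a ** X j b = lw [:: i : nat; j : nat] [:: a; b] (unitT m).
Proof. by rewrite bmulX X_lam. Qed.

(** * A subspace of the kernel *)

(* Unlike Am_ker, this subspace is visibly stable under left multiplication. *)
Inductive null : forall m, Tm m -> Prop :=
| null_0 m : null (0 : Tm m)
| null_lin m c (x y : Tm m) : null x -> null y -> null (c *: x + y)
| null_head m (u v : word) a b (z : Tm m) :
    null (rquad a b (fun c d => consT (mmul u (mmul (fmu c) (mmul (fmu d) v))) z))
| null_cons m w (z : Tm m) : null z -> null (consT w z).

Lemma null_add m (x y : Tm m) : null x -> null y -> null (x + y).
Proof. by move=> nx ny; rewrite -[x]scale1r; apply: null_lin. Qed.

Lemma null_scale m c (x : Tm m) : null x -> null (c *: x).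
Proof. by move=> nx; rewrite -[_ *: _]addr0; apply: null_lin => //; apply: null_0. Qed.

Lemma null_sum m (I : Type) (r : seq I) (F : I -> Tm m) :
  (forall i, null (F i)) -> null (\sum_(i <- r) F i).
Proof.
by move=> nF; apply: big_ind => [|x y|i _]; [apply: null_0|apply: null_add|].
Qed.

Lemma null_mext (B : choiceType) m (f : B -> Tm m) x :
  (forall k, null (f k)) -> null (mext f x).
Proof. by move=> nf; apply: null_sum => k; apply: null_scale. Qed.

Lemma null_rsum m a b (F : 'I_7 -> 'I_7 -> Tm m) :
  (forall c d, null (F c d)) -> null (rsum a b F).
Proof.
by move=> nF; apply: null_sum => c; apply: null_sum => d; apply: null_scale.
Qed.

Lemma null_push1 m a w (F : word -> 'I_7 -> Tm m) :
  (forall u b, null (F u b)) -> null (push1 a w F).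
Proof. by move=> nF; apply: null_mext => p; apply: nF. Qed.

(** The prefix [pre] collects the letters already crossed by a, which keeps the shape of [null_head]
    during the induction on u. At the relation itself [rquad_past2] takes a past both letters,
    leaving a relation behind. *)
Lemma null_push1_quad m (u : seq 'I_7) (pre v : word) a b c (Z : 'I_7 -> Tm m) :
  null (rquad b c (fun c d => push1 a (u ++ c :: d :: v)
    (fun w e => consT (mmul pre w) (Z e)))).
Proof.
elim: u a pre => [|x u IH] a pre.
  have e2 c1 d1 : push1 a ([::] ++ c1 :: d1 :: v)
      (fun w e => consT (mmul pre w) (Z e)) =
    past2 a c1 d1 (fun c2 d2 a2 => push1 a2 v
      (fun w e => consT (mmul pre (mmul (fmu c2) (mmul (fmu d2) w))) (Z e))).
    by rewrite /= push1_cons; apply: eq_rsum => c2 a1; rewrite push1_cons.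
  rewrite (eq_rquad _ _ e2) rquad_past2.
  apply: null_rsum => b1 a1; apply: null_rsum => c1 a2.
  rewrite -(push1_rquad a2 v b1 c1 (fun w e c2 d2 =>
    consT (mmul pre (mmul (fmu c2) (mmul (fmu d2) w))) (Z e))).
  by apply: null_push1 => w e; apply: null_head.
have e1 c1 d1 : push1 a ((x :: u) ++ c1 :: d1 :: v)
      (fun w e => consT (mmul pre w) (Z e)) =
    rsum a x (fun y a1 => push1 a1 (u ++ c1 :: d1 :: v)
      (fun w e => consT (mmul (mmul pre (fmu y)) w) (Z e))).
  rewrite /= push1_cons; apply: eq_rsum => y a1; apply: eq_push1 => w e.
  by apply: (congr1 ((@consT R m)^~ (Z e))); exact: mulmA.
rewrite (eq_rquad _ _ e1) -(rsum_rquad a x b c (fun y a1 c1 d1 =>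
  push1 a1 (u ++ c1 :: d1 :: v) (fun w e => consT (mmul (mmul pre (fmu y)) w) (Z e)))).
by apply: null_rsum => y a1; apply: IH.
Qed.

Lemma lam_rquad m i a b c (F : 'I_7 -> 'I_7 -> Tm m) :
  lam i a (rquad b c F) = rquad b c (fun d e => lam i a (F d e)).
Proof. exact: rquad_linear. Qed.

Lemma consT_rquad m w b c (F : 'I_7 -> 'I_7 -> Tm m) :
  consT w (rquad b c F) = rquad b c (fun d e => consT w (F d e)).
Proof. exact: rquad_linear. Qed.

Lemma null_lam m (z : Tm m) : null z -> forall i a, null (lam i a z).
Proof.
elim=> {m z} [m|m c x y _ IHx _ IHy|m u v b c z|m w z nz IH] i a.
- by rewrite /lam /mext msupp0 big_seq_fset0; apply: null_0.
- by rewrite lam_lin; apply: null_lin.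
- rewrite lam_rquad; case: i => [|i].
    rewrite (@eq_rquad R _ b c _ (fun c d =>
      consT (mmul (mmul (fmu a) u) (mmul (fmu c) (mmul (fmu d) v))) z)).
      exact: null_head.
    move=> d e; rewrite lam0_cons; apply: (congr1 ((@consT R m)^~ z)); exact: mulmA.
  rewrite (@eq_rquad R _ b c _ (fun c d => push1 a (u ++ c :: d :: v)
    (fun w e => consT (mmul mone w) (lam i e z)))); first exact: null_push1_quad.
  move=> d e; rewrite lamS_cons word_cat !word_cons; apply: eq_push1 => w f.
  by rewrite mul1m.
case: i => [|i]; first by rewrite lam0_cons; apply: null_cons.
by rewrite lamS_cons; apply: null_push1 => u b; apply: null_cons; apply: IH.
Qed.

(** Both letters cross the factors before i, [push2_rquad] carries the relation along with them, and
    in factor i it stands at the front of the word. *)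
Lemma null_quad m i a b (z : Tm m) : (i < m)%N ->
  null (rquad a b (fun c d => lam i c (lam i d z))).
Proof.
elim: m i a b z => [//|m IH] i a b z lti.
pose f (z : Tm m.+1) : Tm m.+1 := rquad a b (fun c d => lam i c (lam i d z)).
have fP : linear f.
  move=> c x y; pose g y' d e := lam i d (lam i e (y' : Tm m.+1)).
  apply: (@etrans _ _ (rquad a b (fun d e => c *: g x d e + g y d e))).
    by apply: eq_rquad => d e; rewrite /g !lam_lin.
  exact: rquad_lin1.
have fE := @linear_eq_mext R (m.+1.-tuple word) (Tm m.+1) f z fP.
rewrite -/(f z) fE; apply: null_mext => x; case/tupleP: x => w t.
rewrite -consTU /f; case: i lti {f fP fE} => [|i] lti.
  rewrite (@eq_rquad R _ a b _ (fun c d =>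
    consT (mmul mone (mmul (fmu c) (mmul (fmu d) w))) << t >>)).
    exact: null_head.
  move=> c d; rewrite 2!lam0_cons; apply: (congr1 ((@consT R m)^~ << t >>)).
  by rewrite mul1m.
rewrite (@eq_rquad R _ a b _ (fun c d => push2 c d w
  (fun u c' d' => consT u (lam i c' (lam i d' << t >>))))); last first.
  move=> c d; rewrite lamS_cons lam_push1; apply: eq_push1 => u e.
  by rewrite lamS_cons.
rewrite -push2_rquad; apply: null_push1 => u e; apply: null_push1 => v f.
by have := null_cons v (IH i f e << t >> lti); rewrite consT_rquad.
Qed.

(** * The subspace [null] vanishes in A_m *)

Section Span.
Variables (U : lmodType K) (G : U -> Prop).

Lemma in_span_gen x : G x -> in_span G x.
Proof.
move=> Gx; exists 1%N, (fun=> 1), (fun=> x); split=> //.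
by rewrite big_ord1 scale1r.
Qed.

Lemma in_span0 : in_span G 0.
Proof.
by exists 0%N, (fun=> 0), (fun=> 0); split=> [[]//|]; rewrite big_ord0.
Qed.

Lemma in_span_lin c x y : in_span G x -> in_span G y -> in_span G (c *: x + y).
Proof.
move=> [m [a [g [Gg ->]]]] [n [b [h [Gh ->]]]].
exists (m + n)%N.
exists (fun i => match split i with inl j => c * a j | inr j => b j end).
exists (fun i => match split i with inl j => g j | inr j => h j end); split.
  by move=> i; case: (split i).
rewrite big_split_ord scaler_sumr; congr (_ + _); apply: eq_bigr => i _.
  by rewrite (unsplitK (inl i)) scalerA.
by rewrite (unsplitK (inr i)).
Qed.

Lemma in_span_sum (I : Type) (r : seq I) (c : I -> K) (F : I -> U) :
  (forall i, in_span G (F i)) -> in_span G (\sum_(i <- r) c i *: F i).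
Proof.
move=> FG; apply: (big_ind (in_span G)) => [|x y Gx Gy|i _]; first exact: in_span0.
  by rewrite -[x]scale1r; apply: in_span_lin.
by rewrite -[_ *: _]addr0; apply: in_span_lin => //; apply: in_span0.
Qed.

End Span.

Lemma in_span_linear (U W : lmodType K) (G : U -> Prop) (H : W -> Prop)
    (f : {linear U -> W}) x :
  (forall y, G y -> in_span H (f y)) -> in_span G x -> in_span H (f x).
Proof.
move=> GH [n [c [g [Gg ->]]]]; rewrite linear_sum.
rewrite (eq_bigr (fun i => c i *: f (g i))) => [|i _]; last by rewrite linearZ.
by apply: in_span_sum => i; apply/GH/Gg.
Qed.

Lemma TVdeg2_quad a b :
  TVdeg2 (quad (@Rmap R) (q ^+ 2) (q ^- 12) (delta_mx a b)) =
  rquad a b (fun c d => << mmul (fmu c) (fmu d) >> : TV).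
Proof.
pose F c d : TV := << mmul (fmu c) (fmu d) >>.
have D c d : TVdeg2 (delta_mx c d : 'M[K]_7) = F c d.
  have := @entry_sum_tensor R TV [:: ([:: c; d], (0, 1)%Z)] F.
  by rewrite !tensor_ev_cons !tensor_ev_nil !addr0 !mono_ev_pos !expr0z !scale1r.
have TVlin x (M N : 'M[K]_7) : TVdeg2 (x *: M + N) = x *: TVdeg2 M + TVdeg2 N.
  rewrite /TVdeg2 scaler_sumr -big_split; apply: eq_bigr => c _.
  rewrite scaler_sumr -big_split; apply: eq_bigr => d _.
  by rewrite !mxE scalerDl scalerA.
have T v : TVdeg2 (tensor_ev v (@dlt R)) =
    tensor_ev v (fun w => F (nth p1 w 0) (nth p1 w 1)).
  exact: entry_sum_tensor.
have R1 c d : TVdeg2 (Rmap R (delta_mx c d)) = rsum c d F.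
  by rewrite Rmap_delta T rsumE.
have R2 : TVdeg2 (Rmap R (Rmap R (delta_mx a b))) = rsum a b (fun c d => rsum c d F).
  rewrite Rmap_delta Rmap_tensor T tensor_ev_bind rsumE; apply: eq_tensor_ev => w.
  by rewrite rsumE.
rewrite -[RHS]/(rquad a b F) /rquad -R2 -R1 -D scale1r /quad.
rewrite [X in TVdeg2 X]addrC [X in TVdeg2 (_ + X)]addrC -scaleNr !TVlin.
by rewrite [RHS]addrC [X in _ = _ + X]addrC.
Qed.

Lemma slotU m (t : m.-tuple word) i w :
  slot t i << w >> = << [tuple (if s == i then w else tnth t s) | s < m] >> :> Tm m.
Proof. exact: mextU. Qed.

Lemma malgUM c d (u v : word) : << c *g u >> * << d *g v >> = << c * d *g mmul u v >> :> TV.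
Proof. exact: fgmulUU. Qed.

(** A scalar acts as a multiple of the empty word, which commutes with the word u. *)
Lemma malgU_scaleAr (u : word) c (x : TV) : << u >> * (c *: x) = c *: (<< u >> * x).
Proof.
have e : << u >> * << c *g mone >> = << c *g mone >> * << u >> :> TV.
  by rewrite !malgUM mulr1 mul1r mulm1 mul1m.
apply: etrans (congr1 (fun y => << u >> * y) (esym (mul_malgC c x))) _.
apply: etrans (mulrA _ _ _) _; apply: etrans (congr1 (fun y => y * x) e) _.
exact: etrans (esym (mulrA _ _ _)) (mul_malgC _ _).
Qed.

Lemma sandwich_linear (F : nzRingType) (A : lalgType F) (x y : A) :
  (forall c z, x * (c *: z) = c *: (x * z)) -> linear (fun z => x * z * y).
Proof. by move=> xZ c z t; rewrite mulrDr mulrDl xZ -scalerAl. Qed.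

Lemma Sq_ideal_quad u v a b :
  Sq_ideal (rquad a b (fun c d => << mmul u (mmul (fmu c) (mmul (fmu d) v)) >> : TV)).
Proof.
pose h (x : TV) : TV := << u >> * x * << v >>.
have hP : linear h by apply: sandwich_linear => c z; apply: malgU_scaleAr.
pose hL := GRing.isLinear.Build K TV TV _ h hP.
pose h' : {linear TV -> TV} := HB.pack h hL.
apply: in_span_gen.
exists << u >>, << v >>, (quad (@Rmap R) (q ^+ 2) (q ^- 12) (delta_mx a b)).
split; first exact: R_quad_wedge2.
rewrite TVdeg2_quad -[RHS]/(h' _) rquad_linear; apply: eq_rquad => c d.
by rewrite -[RHS]/(<< u >> * << mmul (fmu c) (fmu d) >> * << v >>) !malgUM !mulr1 -!mulmA.
Qed.

Lemma Am_ker_lin m c (x y : Tm m) : Am_ker x -> Am_ker y -> Am_ker (c *: x + y).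
Proof. exact: in_span_lin. Qed.

Lemma Am_ker_head m (u v : word) a b (z : Tm m) :
  Am_ker (rquad a b (fun c d => consT (mmul u (mmul (fmu c) (mmul (fmu d) v))) z)).
Proof.
pose W c d := mmul u (mmul (fmu c) (mmul (fmu d) v)).
(* The entry [mone] of the auxiliary tuple is overwritten by [slot]. *)
have e c d : consT (W c d) z =
    mext (fun t : m.-tuple word => slot [tuple of (mone : word) :: t] ord0 << W c d >>) z.
  apply: eq_mext => t; rewrite slotU; congr << _ >>.
  apply: eq_from_tnth => s; rewrite tnth_mktuple; case: (unliftP ord0 s) => [j ->|->].
    by rewrite !tnthS.
  by rewrite tnth0.
rewrite (eq_rquad _ _ e) -(mext_rquad a b (fun (t : m.-tuple word) c d =>
  slot [tuple of (mone : word) :: t] ord0 << W c d >>)).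
apply: in_span_sum => t; apply: in_span_gen.
exists [tuple of (mone : word) :: t], ord0, (rquad a b (fun c d => << W c d >>)).
split; first exact: Sq_ideal_quad.
by rewrite [RHS](rquad_linear (mext _)).
Qed.

Lemma Am_ker_cons m w (z : Tm m) : Am_ker z -> Am_ker (consT w z).
Proof.
apply: (in_span_linear (f := @consT R m w)) => _ [t [i [y [yI ->]]]].
apply: in_span_gen; exists [tuple of w :: t], (lift ord0 i), y; split=> //.
rewrite /slot (mext_comp (@consT R m w)); apply: eq_mext => u.
rewrite /= consTU; congr << _ >>.
apply: eq_from_tnth => s; rewrite tnth_mktuple; case: (unliftP ord0 s) => [j ->|->].
  by rewrite !tnthS tnth_mktuple (inj_eq lift_inj).
by rewrite !tnth0.
Qed.

Lemma null_Am_ker m (z : Tm m) : null z -> Am_ker z.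
Proof.
elim=> {m z} [m|m c x y _ IHx _ IHy|m u v a b z|m w z _].
- exact: in_span0.
- exact: Am_ker_lin.
- exact: Am_ker_head.
exact: Am_ker_cons.
Qed.

End Products.

(** * Identities in the tensor powers of V *)

Definition phi_tensor : tensor :=
  [:: ([:: p1; m1], (4, 1)); ([:: m1; p1], (-6, 1)); ([:: p2; m2], (3, 1));
      ([:: m2; p2], (-5, 1)); ([:: p3; m3], (0, 1)); ([:: m3; p3], (-2, 1));
      ([:: z0; z0], (0, 1))]%Z.

(* The tensor product of u and v, where u has degree 2. *)
Definition tcat (u v : tensor) : tensor :=
  tbind u (fun x => [seq (nth p1 x 0 :: nth p1 x 1 :: t.1, t.2) | t <- v]).

Definition phi2_tensor : tensor := tcat phi_tensor phi_tensor.

(** The values gamma(v_a) follow from gamma(v_1) along the same chain v_{a+1} = +- F_i v_a as in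
    [R_table]. *)
Definition gamma_table : seq tensor := Eval vm_compute in
  gamma_top :: scanl (fun g s => collect
      (tscale [:: (0%Z, s.2)] (tbind g (act_word (gF s.1.2))))) gamma_top
    [:: (p1, ord0, 1%Z); (p2, ord_max, 1%Z); (p3, ord0, 1%Z);
        (z0, ord0, (-1)%Z); (m3, ord_max, (-1)%Z); (m2, ord0, (-1)%Z)].

Definition gamma_letter (a : 'I_7) : tensor := nth [::] gamma_table a.

Definition upsilon_tensor : tensor := Eval vm_compute in
  collect (tscale (qX 6) (tbind phi_tensor (fun w =>
    tcat (gamma_letter (nth p1 w 0)) (gamma_letter (nth p1 w 1))))).

Definition swap_tensor (k : nat) (v : tensor) : tensor :=
  collect (tbind v (R_at k)).

Definition swaps_tensor (ks : seq nat) (v : tensor) : tensor :=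
  foldl (fun v k => swap_tensor k v) v ks.

Definition quad_tensor (k : nat) (v : tensor) : tensor :=
  let w := swap_tensor k v in
  swap_tensor k w ++ tscale [:: (2, -1); (-12, -1)]%Z w ++ tscale (qX (-10)) v.

Definition dim_laurent : laurent := [seq (e, 1%Z) | e <- [:: 10; 8; 2; 0; -2; -8; -10]%Z].

(* With f(x) = (x - q^2)(x - q^-12), quad_multiple is f(-1) f(-q^-6) and
   quad_cofactor applies A(Rcheck), where A is the linear polynomial such that
   A f = f(-1) f(-q^-6) at the other two eigenvalues -1 and -q^-6 of Rcheck. *)
Definition quad_multiple : laurent :=
  [seq mono_mul s t | s <- [:: (0, 1); (2, 1); (-12, 1); (-10, 1)]%Z,
                      t <- [:: (-12, 1); (-18, 1); (-4, 1); (-10, 1)]%Z].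

Definition quad_cofactor (k : nat) (v : tensor) : tensor :=
  collect (tscale [:: (0, 1); (-6, 1); (2, 1); (-12, 1)]%Z (v ++ swap_tensor k v)
           ++ tscale [:: (-12, 1); (-18, 1); (-4, 1); (-10, 1)]%Z v).

(** By the choice of A this tests whether v lies in \wedge_q^2 V at positions k and k + 1, and it
    exhibits a nonzero multiple of v as an image of f(Rcheck). *)
Definition quad_member (k : nat) (v : tensor) : bool :=
  teq (tscale quad_multiple v) (quad_tensor k (quad_cofactor k v)).

(** The three products are sorted to a common order of slots and the relation is multiplied by dim_q
    V, so that no quotient occurs; the last factor is -(1 - q^14). *)
Definition dim_relation (ks1 ks2 ks3 : seq nat) : tensor :=
  collect (tscale dim_laurent (swaps_tensor ks1 phi2_tensor ++
             tscale (qXN 2) (swaps_tensor ks2 phi2_tensor))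
           ++ tscale [:: (14, 1); (0, -1)]%Z (swaps_tensor ks3 phi2_tensor)).

(** Both identities reflect the invariance of phi, which crosses every letter unchanged: two
    adjacent copies can be interchanged, and one copy can be inserted into the other from either
    side. *)
Lemma phi_commute_check :
  teq phi2_tensor (swaps_tensor [:: 1; 0; 2; 1]%N phi2_tensor) &&
  teq (swaps_tensor [:: 1; 0]%N phi2_tensor) (swaps_tensor [:: 1; 2]%N phi2_tensor).
Proof. by vm_compute. Qed.

(** These are the second relation for k > j and for k < i, then the third one for k > j and for k <
    i. The sorted slots are i i j k, k i i j, i j j k and k i j j, and the membership test is placed
    at the repeated slot. *)
Lemma dim_relation_check :
  [&& quad_member 0 (dim_relation [:: 1; 2]%N [:: 1]%N [::]),
      quad_member 1 (dim_relation [:: 0]%N [:: 2; 1; 0; 2]%N [:: 2; 1; 0]%N),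
      quad_member 1 (dim_relation [::] [:: 1; 0; 2]%N [:: 1; 0]%N) &
      quad_member 2 (dim_relation [:: 2; 1; 0]%N [:: 0; 1]%N [:: 2; 1; 0; 2; 1]%N)].
Proof. by vm_compute. Qed.

(** For i < k < j < l the swaps [[:: 1; 0; 2]], [[:: 1]] and [[:: 1; 2]] sort the slots k l i j, i j
    k l and i l k j to i k j l, the order of the slots in Upsilon. *)
Lemma upsilon_relation_check :
  teq (tscale (qX (-1)) (swaps_tensor [:: 1; 0; 2]%N phi2_tensor)
       ++ tscale (qXN 1) (swaps_tensor [:: 1]%N phi2_tensor))
      (tscale [:: (1, 1); (-1, -1)]%Z
        (swaps_tensor [:: 1; 2]%N phi2_tensor
         ++ tscale [:: (2, -1); (-2, -1)]%Z phi2_tensor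
         ++ upsilon_tensor)).
Proof. by vm_compute. Qed.

Definition phi_left (a : 'I_7) : tensor := tcat phi_tensor (tletter 0 a).
Definition phi_right (a : 'I_7) : tensor :=
  [seq (a :: t.1, t.2) | t <- phi_tensor].

Lemma phi_letter_check :
  all (fun a => teq (phi_right a) (swaps_tensor [:: 1; 0]%N (phi_left a)) &&
                teq (phi_left a) (swaps_tensor [:: 0; 1]%N (phi_right a))) letters.
Proof. by vm_compute. Qed.

(* phi (x) v_a - v_a (x) phi lies in
   \wedge_q^2 V (x) V + V (x) \wedge_q^2 V; the coefficients solve a linear
   system in the space of U_q-maps V -> V^{(x) 3}, which has dimension 4. *)
Definition central_multiple : laurent :=
  [seq (e, 1%Z) | e <- [:: 0; 4; 6; 8; 10; 12; 14; 18]%Z].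

Definition central_cofactor (k : nat) (v : tensor) : tensor :=
  tscale [seq (e, 1%Z) | e <- [:: 10; 12; 16; 16; 18; 22; 24; 28]%Z] v
  ++ tscale [seq (e, 1%Z) | e <- [:: 16; 22; 24; 28]%Z] (swap_tensor k v).

Lemma phi_central_check :
  all (fun a =>
    teq (tscale central_multiple (phi_right a ++ tscale (qXN 0) (phi_left a)))
        (quad_tensor 0 (central_cofactor 0 (phi_right a)) ++
         tscale (qXN 0) (quad_tensor 1 (central_cofactor 1 (phi_left a)))))
    letters.
Proof. by vm_compute. Qed.

(** * Sorting words by exchanges *)

Section Sorting.
Variable R : realType.
Local Notation K := (Cq R).
Local Notation q := (@qv R).
Local Notation Tm := (Tm R).
Local Notation unitT := (unitT R).

Definition teval m (s : seq nat) (v : tensor) (z : Tm m) : Tm m :=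
  tensor_ev v (fun w => lw s w z).

Lemma teval_cat m s v w (z : Tm m) : teval s (v ++ w) z = teval s v z + teval s w z.
Proof. exact: tensor_ev_cat. Qed.

Lemma teval_scale m s l v (z : Tm m) :
  teval s (tscale l v) z = laurent_ev R l *: teval s v z.
Proof. exact: tensor_ev_scale. Qed.

Lemma teval_collect m s v (z : Tm m) : teval s (collect v) z = teval s v z.
Proof. exact: tensor_ev_collect. Qed.

Lemma teval_teq m s v w (z : Tm m) : teq v w -> teval s v z = teval s w z.
Proof. exact: teqP. Qed.

Lemma lam_tensor m i a v (f : seq 'I_7 -> Tm m) :
  lam i a (tensor_ev v f) = tensor_ev v (fun w => lam i a (f w)).
Proof. exact: tensor_ev_linear. Qed.

Lemma lw_cons m i s w (z : Tm m) :
  lw (i :: s) w z = lam i (nth p1 w 0) (lw s (behead w) z).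
Proof. by []. Qed.

Lemma lw_tensor m s w v (f : seq 'I_7 -> Tm m) :
  lw s w (tensor_ev v f) = tensor_ev v (fun u => lw s w (f u)).
Proof.
elim: s w => [//|i s IH] w; rewrite lw_cons IH; exact: lam_tensor.
Qed.

Definition swap_seq (k : nat) (s : seq nat) : seq nat :=
  take k s ++ nth 0 s k.+1 :: nth 0 s k :: drop k.+2 s.

Lemma lw_swap m k s w (z : Tm m) :
  (k.+1 < size s)%N -> (nth 0 s k.+1 < nth 0 s k)%N ->
  lw s w z = tensor_ev (R_at k w) (fun u => lw (swap_seq k s) u z).
Proof.
elim: k s w => [|k IH] [//|i s] w; last first.
  move=> ltk lts; rewrite lw_cons (IH s (behead w) ltk lts) lam_tensor.
  by rewrite [RHS]tensor_ev_R_atS.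
case: s => [//|j s] _ ltji; rewrite [RHS]tensor_ev_R_at0 !lw_cons.
rewrite (lam_exchange _ _ _ (ltji : (j < i)%N)) nth_behead; apply: eq_rsum => c d.
rewrite /swap_seq [take 0 _]/= [drop _ _]/= drop0 cat0s !lw_cons.
by rewrite -[behead (behead w)]drop1 -[behead w]drop1 drop_drop.
Qed.

Lemma teval_swap m k s v (z : Tm m) :
  (k.+1 < size s)%N -> (nth 0 s k.+1 < nth 0 s k)%N ->
  teval s v z = teval (swap_seq k s) (swap_tensor k v) z.
Proof.
move=> ltk lts; rewrite teval_collect /teval tensor_ev_bind.
by apply: eq_tensor_ev => w; apply: lw_swap.
Qed.

Definition swaps_seq (ks s : seq nat) : seq nat :=
  foldl (fun s k => swap_seq k s) s ks.

(** Every exchange has to act at a descent of the slots, where [lam_exchange] applies. *)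
Fixpoint swappable (ks s : seq nat) : bool :=
  if ks is k :: ks' then
    [&& (k.+1 < size s)%N, (nth 0 s k.+1 < nth 0 s k)%N & swappable ks' (swap_seq k s)]
  else true.

Lemma teval_swaps m ks s v (z : Tm m) : swappable ks s ->
  teval s v z = teval (swaps_seq ks s) (swaps_tensor ks v) z.
Proof.
elim: ks s v => [//|k ks IH] s v /= /and3P[ltk lts ok].
by rewrite (teval_swap v z ltk lts) IH.
Qed.

Lemma tensor_evD (U : lmodType K) v (f g : seq 'I_7 -> U) :
  tensor_ev v f + tensor_ev v g = tensor_ev v (fun w => f w + g w).
Proof. by rewrite -big_split; apply: eq_bigr => t _; rewrite scalerDr. Qed.

Lemma tensor_evZ (U : lmodType K) c v (f : seq 'I_7 -> U) :
  c *: tensor_ev v f = tensor_ev v (fun w => c *: f w).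
Proof.
by rewrite scaler_sumr; apply: eq_bigr => t _; rewrite !scalerA mulrC.
Qed.

Definition quad_ev (U : lmodType K) k (f : seq 'I_7 -> U) (w : seq 'I_7) : U :=
  1 *: tensor_ev (R_at k w) (fun u => tensor_ev (R_at k u) f)
  + (- (q ^+ 2 + q ^- 12)) *: tensor_ev (R_at k w) f + (q ^+ 2 * q ^- 12) *: f w.

Lemma tensor_ev_quad (U : lmodType K) k v (f : seq 'I_7 -> U) :
  tensor_ev (quad_tensor k v) f = tensor_ev v (quad_ev k f).
Proof.
have c1 : laurent_ev R [:: (2, -1); (-12, -1)]%Z = - (q ^+ 2 + q ^- 12).
  by rewrite /laurent_ev big_cons big_seq1 !mono_ev_neg opprD.
have c0 : laurent_ev R (qX (-10)) = q ^+ 2 * q ^- 12.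
  by rewrite laurent_ev_qX [LHS](_ : _ = q ^ (2 - 12)) // expfzDr ?qv_neq0.
cbv beta zeta delta [quad_tensor]; rewrite 2!tensor_ev_cat 2!tensor_ev_scale c0 c1.
rewrite !tensor_ev_collect !tensor_ev_bind tensor_ev_collect tensor_ev_bind.
rewrite 2!tensor_evZ 2!tensor_evD; apply: eq_tensor_ev => w.
by rewrite /quad_ev scale1r addrA.
Qed.

Lemma quad_ev_linear (U W : lmodType K) (h : {linear U -> W}) k f w :
  h (quad_ev k f w) = quad_ev k (h \o f) w.
Proof.
rewrite /quad_ev !linearD !linearZ /= !tensor_ev_linear.
by congr (_ + _ + _); apply: eq_tensor_ev => u; rewrite tensor_ev_linear.
Qed.

Lemma quad_ev0 (U : lmodType K) w (f : seq 'I_7 -> U) :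
  f w = f (nth p1 w 0 :: nth p1 w 1 :: drop 2 w) ->
  quad_ev 0 f w =
  rquad (nth p1 w 0) (nth p1 w 1) (fun c d => f (c :: d :: drop 2 w)).
Proof.
move=> fw; rewrite /quad_ev fw.
rewrite !tensor_ev_R_at0 /rquad; congr (_ *: _ + _ + _).
by apply: eq_rsum => c d; rewrite tensor_ev_R_at0 /= drop0.
Qed.

Lemma quad_evS (U : lmodType K) k w (f : seq 'I_7 -> U) :
  f w = f (nth p1 w 0 :: behead w) ->
  quad_ev k.+1 f w = quad_ev k (fun u => f (nth p1 w 0 :: u)) (behead w).
Proof.
move=> fw; rewrite /quad_ev fw !tensor_ev_R_atS.
congr (_ *: _ + _ + _); apply: eq_tensor_ev => u; exact: tensor_ev_R_atS.
Qed.

Lemma null_quad_ev m pre i suf w (z : Tm m) : (i < m)%N ->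
  null (quad_ev (size pre) (fun u => lw (pre ++ i :: i :: suf) u z) w).
Proof.
move=> lti; elim: pre w => [|p pre IH] w.
  have fw : lw [:: i, i & suf] w z =
      lw [:: i, i & suf] (nth p1 w 0 :: nth p1 w 1 :: drop 2 w) z.
    by rewrite !lw_cons !nth_behead -[behead (behead w)]drop1 -[behead w]drop1 drop_drop.
  rewrite (@quad_ev0 _ w (fun u => lw [:: i, i & suf] u z) fw).
  exact: (null_quad _ _ (lw suf (drop 2 w) z) lti).
rewrite (@quad_evS _ (size pre) w (fun u => lw (p :: pre ++ [:: i, i & suf]) u z) erefl).
by have := null_lam (IH (behead w)) p (nth p1 w 0); rewrite quad_ev_linear.
Qed.

Lemma null_tensor m v (f : seq 'I_7 -> Tm m) :
  (forall w, null (f w)) -> null (tensor_ev v f).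
Proof. by move=> nf; apply: null_sum => t; apply: null_scale. Qed.

Lemma null_teval_quad m k s v (z : Tm m) : (k.+1 < size s)%N ->
  nth 0 s k = nth 0 s k.+1 -> (nth 0 s k < m)%N -> null (teval s (quad_tensor k v) z).
Proof.
move=> ltk sk ltm; rewrite /teval tensor_ev_quad; apply: null_tensor => w.
have sE : s = take k s ++ nth 0 s k :: nth 0 s k :: drop k.+2 s.
  by rewrite {2}sk -(drop_nth 0 ltk) -(drop_nth 0 (ltnW ltk)) cat_take_drop.
have := null_quad_ev (take k s) (drop k.+2 s) w z ltm.
by rewrite -sE size_takel // ltnW // ltnW.
Qed.

Lemma null_scaleI m c (x : Tm m) : c != 0 -> null (c *: x) -> null x.
Proof. by move=> c0 /(null_scale c^-1); rewrite scalerA mulVf // scale1r. Qed.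

Lemma quad_member_null m k s v (z : Tm m) : quad_member k v ->
  (k.+1 < size s)%N -> nth 0 s k = nth 0 s k.+1 -> (nth 0 s k < m)%N ->
  null (teval s v z).
Proof.
move=> /(teval_teq s z) e ltk sk ltm.
apply: (null_scaleI (laurent_neq0P R (isT : laurent_neq0 quad_multiple))).
by rewrite -teval_scale e; apply: null_teval_quad.
Qed.

End Sorting.

(** * Products of two invariants, and centrality of Phi^{(i,i)} *)

Section PhiProducts.
Variable R : realType.
Local Notation K := (Cq R).
Local Notation q := (@qv R).
Local Notation Tm := (Tm R).
Local Notation unitT := (unitT R).

Lemma tensor_ev_tcat (U : lmodType K) u v (f : seq 'I_7 -> U) :
  tensor_ev (tcat u v) f =
  tensor_ev u (fun x => tensor_ev v (fun y => f (nth p1 x 0 :: nth p1 x 1 :: y))).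
Proof.
rewrite tensor_ev_bind; apply: eq_tensor_ev => x.
exact: (tensor_ev_map (fun y => nth p1 x 0 :: nth p1 x 1 :: y)).
Qed.

Lemma tensor_ev_exchange (U : lmodType K) u v (f : seq 'I_7 -> seq 'I_7 -> U) :
  tensor_ev u (fun x => tensor_ev v (f x)) = tensor_ev v (fun y => tensor_ev u (f^~ y)).
Proof.
rewrite /tensor_ev; under eq_bigr => s _ do rewrite scaler_sumr.
rewrite exchange_big; apply: eq_bigr => s _; rewrite scaler_sumr.
by apply: eq_bigr => t _; rewrite !scalerA mulrC.
Qed.

Lemma tensor_evB (U : lmodType K) v (f g : seq 'I_7 -> U) :
  tensor_ev v f - tensor_ev v g = tensor_ev v (fun w => f w - g w).
Proof. by rewrite -sumrB; apply: eq_bigr => t _; rewrite scalerBr. Qed.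

Lemma teval_tcat m i j s u v (z : Tm m) :
  teval [:: i, j & s] (tcat u v) z = teval [:: i; j] u (teval s v z).
Proof.
rewrite [LHS]tensor_ev_tcat; apply: eq_tensor_ev => x.
rewrite lw_tensor; apply: eq_tensor_ev => y.
by rewrite !lw_cons !nth_behead.
Qed.

Lemma teval_tensor m s v u (f : seq 'I_7 -> Tm m) :
  teval s v (tensor_ev u f) = tensor_ev u (fun w => teval s v (f w)).
Proof.
rewrite /teval -[RHS]tensor_ev_exchange; apply: eq_tensor_ev => w.
exact: lw_tensor.
Qed.

Lemma sum7A (V : zmodType) (a b c d e f g : V) :
  a + b + c + d + e + f + g = a + (b + (c + (d + (e + (f + g))))).
Proof. by rewrite !addrA. Qed.

Lemma tensor_ev_phi (U : lmodType K) (f : seq 'I_7 -> U) :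
  tensor_ev phi_tensor f =
  q ^+ 4 *: f [:: p1; m1] + q ^- 6 *: f [:: m1; p1] + q ^+ 3 *: f [:: p2; m2]
  + q ^- 5 *: f [:: m2; p2] + f [:: p3; m3] + q ^- 2 *: f [:: m3; p3] + f [:: z0; z0].
Proof.
rewrite /phi_tensor !tensor_ev_cons tensor_ev_nil addr0 !mono_ev_pos expr0z.
by rewrite 2!scale1r sum7A.
Qed.

Lemma phi_tensorE : phi R = tensor_ev phi_tensor (@dlt R).
Proof. exact: esym (tensor_ev_phi (@dlt R)). Qed.

Lemma Phi_teval m (i j : 'I_m) :
  Phi i j = @teval R m [:: i : nat; j : nat] phi_tensor (unitT m).
Proof.
rewrite /Phi phi_tensorE (entry_sum_tensor _ (fun a b => X i a ** X j b)).
by apply: eq_tensor_ev => w; rewrite XX_lw !lw_cons !nth_behead.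
Qed.

Lemma bmul_tensor m v (f : seq 'I_7 -> Tm m) y :
  tensor_ev v f ** y = tensor_ev v (fun w => f w ** y).
Proof. exact: (tensor_ev_linear (mext (fun s => mext (mul_tuple R s) y))). Qed.

Lemma bmul_Phi m (i j : 'I_m) (y : Tm m) :
  Phi i j ** y = teval [:: i : nat; j : nat] phi_tensor y.
Proof.
rewrite Phi_teval bmul_tensor; apply: eq_tensor_ev => w.
exact: bmul_lw2.
Qed.

Lemma Phi_Phi m (i j k l : 'I_m) :
  (Phi i j : Tm m) ** Phi k l =
  teval [:: i : nat; j : nat; k : nat; l : nat] phi2_tensor (unitT m).
Proof. by rewrite teval_tcat bmul_Phi Phi_teval. Qed.

Local Opaque Phi bmul lam.

Lemma teval_left m i j a (z : Tm m) :
  teval [:: i; i; j] (phi_left a) z = teval [:: i; i] phi_tensor (lam j a z).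
Proof.
by rewrite teval_tcat [teval [:: j] _ _]tensor_ev_tletter expr0z scale1r.
Qed.

Lemma teval_right m i j a (z : Tm m) :
  teval [:: j; i; i] (phi_right a) z = lam j a (teval [:: i; i] phi_tensor z).
Proof. by rewrite /teval [LHS](tensor_ev_map (cons a)) lam_tensor. Qed.

(** For i and j distinct, phi crosses the letter unchanged and the difference is zero. For i = j the
    three letters share a slot, no exchange is available, and the difference is a combination of
    relations at the first two and at the last two places. *)
Lemma null_phi_lam m (i j : 'I_m) a (z : Tm m) :
  null (teval [:: i : nat; i : nat] phi_tensor (lam j a z)
        - lam j a (teval [:: i : nat; i : nat] phi_tensor z)).
Proof.
have /andP[eR eL] := all_letters phi_letter_check a.
rewrite -teval_left -teval_right; have [ltij|ltji|/val_inj eij] := ltngtP i j.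
- rewrite [X in _ - X](@teval_swaps R _ [:: 0; 1]%N); last by rewrite /= ltij.
  by rewrite -(teval_teq [:: i : nat; i : nat; j : nat] z eL) subrr; apply: null_0.
- rewrite [X in X - _](@teval_swaps R _ [:: 1; 0]%N); last by rewrite /= ltji.
  by rewrite -(teval_teq [:: j : nat; i : nat; i : nat] z eR) subrr; apply: null_0.
(* [phi_central_check] concerns the opposite difference. *)
rewrite -eij -opprB -scaleN1r; apply: null_scale.
apply: (null_scaleI (laurent_neq0P R (isT : laurent_neq0 central_multiple))).
have := teval_teq [:: i : nat; i : nat; i : nat] z (all_letters phi_central_check a).
rewrite teval_scale [in X in _ *: X]teval_cat [in X in _ *: X]teval_scale.
rewrite laurent_ev_qXN expr0z scaleN1r => ->.
have nq k v : (k < 2)%N -> null (teval [:: i : nat; i : nat; i : nat] (quad_tensor k v) z).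
  by case: k => [|[|//]] _; apply: null_teval_quad => //=; apply: ltn_ord.
rewrite teval_cat; apply: null_add; first exact: nq.
by rewrite teval_scale; apply: null_scale; apply: nq.
Qed.

Lemma Phi_diag_central m (i j k : 'I_m) :
  null (Phi i i ** Phi j k - Phi j k ** Phi i i : Tm m).
Proof.
pose P := @teval R m [:: i : nat; i : nat] phi_tensor.
pose Q := @teval R m [:: j : nat; k : nat] phi_tensor.
have e1 : Phi i i ** Phi j k = P (Q (unitT m)).
  exact: (etrans (bmul_Phi i i (Phi j k)) (congr1 P (Phi_teval j k))).
have e2 : Phi j k ** Phi i i = Q (P (unitT m)).
  exact: (etrans (bmul_Phi j k (Phi i i)) (congr1 Q (Phi_teval i i))).
rewrite (f_equal2 (fun x y => x - y) e1 e2).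
have PE : P (teval [:: j : nat; k : nat] phi_tensor (unitT m)) =
    tensor_ev phi_tensor (fun w => P (lw [:: j : nat; k : nat] w (unitT m))).
  exact: teval_tensor.
rewrite PE tensor_evB; apply: null_tensor => w.
have nP k' a y : (k' < m)%N -> null (P (lam k' a y) - lam k' a (P y)).
  by move=> ltk; apply: (null_phi_lam i (Ordinal ltk)).
pose a := nth p1 w 0; pose b := nth p1 (behead w) 0; pose y := lam k b (unitT m).
(* Telescoping: [P] is moved past the letter in slot j, then past the letter in slot k. *)
have -> : P (lw [:: j : nat; k : nat] w (unitT m)) - lw [:: j : nat; k : nat] w (P (unitT m)) =
    (P (lam j a y) - lam j a (P y)) + lam j a (P y - lam k b (P (unitT m))).
  have -> : lam j a (P y - lam k b (P (unitT m))) =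
      lam j a (P y) - lam j a (lam k b (P (unitT m))) by exact: linearB.
  by rewrite addrA subrK.
by apply: null_add; [|apply: null_lam]; apply: nP.
Qed.

End PhiProducts.

(** * Relations with the quantum dimension, and Upsilon *)

Section DimAndUpsilon.
Variable R : realType.
Local Notation K := (Cq R).
Local Notation q := (@qv R).
Local Notation Tm := (Tm R).
Local Notation unitT := (unitT R).

Local Opaque Phi bmul lam.

Lemma eqA_null m (x y x' y' : Tm m) : x = x' -> y = y' -> null (x' - y') -> x =A y.
Proof. by move=> -> ->; apply: null_Am_ker. Qed.

Lemma dimqVE : dimqV = laurent_ev R dim_laurent.
Proof.
rewrite /dimqV sum7A /laurent_ev.
rewrite !big_cons big_nil addr0.
by rewrite !mono_ev_pos expr0z !exprnN !exprnP.
Qed.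

Lemma dimqV_neq0 : dimqV != 0 :> K.
Proof. by rewrite dimqVE; apply: laurent_neq0P. Qed.

Lemma dim_relation_null m k s s1 s2 s3 ks1 ks2 ks3 (z : Tm m) :
  quad_member k (dim_relation ks1 ks2 ks3) ->
  [&& swappable ks1 s1, swappable ks2 s2 & swappable ks3 s3] ->
  [/\ swaps_seq ks1 s1 = s, swaps_seq ks2 s2 = s & swaps_seq ks3 s3 = s] ->
  (k.+1 < size s)%N -> nth 0%N s k = nth 0%N s k.+1 -> (nth 0%N s k < m)%N ->
  null (teval s1 phi2_tensor z - q ^+ 2 *: teval s2 phi2_tensor z
        - ((1 - q ^+ 14) / dimqV) *: teval s3 phi2_tensor z).
Proof.
move=> mem /and3P[ok1 ok2 ok3] [e1 e2 e3] ltk sk ltm.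
rewrite (teval_swaps _ z ok1) (teval_swaps _ z ok2) (teval_swaps _ z ok3) e1 e2 e3.
have := quad_member_null z mem ltk sk ltm.
rewrite /dim_relation teval_collect teval_cat !teval_scale teval_cat teval_scale.
rewrite laurent_ev_qXN -dimqVE scaleNr => h; apply: (null_scaleI dimqV_neq0).
set E1 := teval s _ z in h *; set E2 := teval s _ z in h *; set E3 := teval s _ z in h *.
have <- : dimqV *: (E1 - q ^ int_of_Z 2 *: E2) +
    laurent_ev R [:: (14, 1); (0, -1)]%Z *: E3 =
  dimqV *: (E1 - q ^+ 2 *: E2 - ((1 - q ^+ 14) / dimqV) *: E3); last exact: h.
rewrite [RHS]scalerBr scalerA mulrC divfK ?dimqV_neq0 //; congr (_ + _).
rewrite -scaleNr; apply: (congr1 (fun x => x *: E3)); rewrite opprB.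
by rewrite /laurent_ev big_cons big_seq1 mono_ev_pos mono_ev_neg expr0z.
Qed.

Section Gamma.
Variable gamma : 'Hom('rV[K]_7, 'M[K]_7).
Hypotheses (gamma_Uq : is_Uqmap gamma) (gamma1 : gamma (bvec R p1) = gamma_v1).

(** Since F_i v_a = c v_{a'} with c c = 1, multiplying by c once more recovers v_{a'}. *)
Lemma gamma_step i a a' c v :
  F_letter i a = [:: ([:: a'], (0, c)%Z)] -> (c * c)%Z = 1%Z ->
  gamma (bvec R a) = tensor_ev v (@dlt R) ->
  gamma (bvec R a') =
    tensor_ev (collect (tscale [:: (0, c)%Z] (tbind v (act_word (gF i))))) (@dlt R).
Proof.
move=> Fa cc ga; rewrite tensor_ev_collect tensor_ev_scale -actVV_tensor -ga.
rewrite -gamma_Uq.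
have -> : bvec R a *m actV R (gF i) = mono_ev R (0, c)%Z *: bvec R a'.
  rewrite -rowE; have := row_comb_actF (bvec R) i a; rewrite Fa.
  rewrite tensor_ev_cons tensor_ev_nil addr0 => <-; rewrite /row_comb.
  by rewrite [LHS]row_sum_delta; apply: eq_bigr => d _; rewrite mxE.
rewrite linearZ /= scalerA /laurent_ev big_seq1 -mono_ev_mul /mono_mul /= cc.
by rewrite mono_ev_pos expr0z scale1r.
Qed.

(** The right-hand side follows the order of the six terms of [gamma_top]. *)
Lemma gamma_expand (U : lmodType K) (A B C D : U) a b c :
  A - a *: B - (b + c) *: (C - b *: D) =
  A + (- a *: B + (- b *: C + (- c *: C + ((b * b) *: D + (c * b) *: D)))).
Proof.
rewrite scalerDl !scalerBr !scalerA opprD !opprB !scaleNr -!addrA.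
congr (_ + (_ + _)); rewrite addrCA; congr (_ + _).
by rewrite addrA addrC.
Qed.

Lemma tensor_ev_gamma_top (U : lmodType K) (f : seq 'I_7 -> U) :
  tensor_ev gamma_top f =
  f [:: p1; z0] - q ^- 6 *: f [:: z0; p1]
  - (q ^- 3 + q^-1) *: (f [:: p2; p3] - q ^- 3 *: f [:: p3; p2]).
Proof.
rewrite gamma_expand -(exprN1 q) !exprnN -!expfzDr ?qv_neq0 //.
rewrite /gamma_top !tensor_ev_cons tensor_ev_nil addr0.
by rewrite !mono_ev_pos !mono_ev_neg expr0z scale1r.
Qed.

Lemma gamma_top_E : gamma (bvec R p1) = tensor_ev gamma_top (@dlt R).
Proof.
have tE a b : tens (bvec R a) (bvec R b) = delta_mx a b.
  by rewrite /tens /bvec trmx_delta mul_delta_mx.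
by rewrite gamma1 /gamma_v1 !tE; apply: esym (tensor_ev_gamma_top (@dlt R)).
Qed.

Lemma gamma_letterE a : gamma (bvec R a) = tensor_ev (gamma_letter a) (@dlt R).
Proof.
have g1 := gamma_top_E.
have g2 := @gamma_step ord0 p1 p2 1 _ erefl erefl g1.
have g3 := @gamma_step ord_max p2 p3 1 _ erefl erefl g2.
have g0 := @gamma_step ord0 p3 z0 1 _ erefl erefl g3.
have h3 := @gamma_step ord0 z0 m3 (-1) _ erefl erefl g0.
have h2 := @gamma_step ord_max m3 m2 (-1) _ erefl erefl h3.
have h1 := @gamma_step ord0 m2 m1 (-1) _ erefl erefl h2.
by elim/letter_ind: a;
  [rewrite g1|rewrite g2|rewrite g3|rewrite g0|rewrite h3|rewrite h2|rewrite h1];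
  congr tensor_ev; vm_compute.
Qed.

Lemma sum_bilinear (U : lmodType K) (I J L : finType) (c : K) (P : I -> K)
    (g : I -> J -> K) (h : I -> L -> K) (G : J -> L -> U) :
  \sum_r \sum_s (c * \sum_p P p * g p r * h p s) *: G r s =
  c *: \sum_p P p *: \sum_r g p r *: \sum_s h p s *: G r s.
Proof.
rewrite scaler_sumr.
under [RHS]eq_bigr => p _ do rewrite scalerA scaler_sumr.
rewrite [RHS]exchange_big; apply: eq_bigr => r _.
under [RHS]eq_bigr => p _ do rewrite scalerA scaler_sumr.
rewrite [RHS]exchange_big; apply: eq_bigr => s _.
rewrite mulr_sumr scaler_suml; apply: eq_bigr => p _.
by rewrite scalerA !mulrA.
Qed.

(** Separates the two occurrences of gamma in the coefficients of Upsilon, so that each double sum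
    becomes an evaluation by [entry_sum_tensor]. *)
Lemma entry_sum_bilinear (U : lmodType K) (c : K) (P : 'M[K]_7)
    (g : 'I_7 -> 'M[K]_7) (F : 'I_7 -> 'I_7 -> 'I_7 -> 'I_7 -> U) :
  \sum_(a < 7) \sum_(b < 7) \sum_(d < 7) \sum_(e < 7)
    (c * \sum_(f < 7) \sum_(h < 7) P f h * g f a b * g h d e) *: F a b d e =
  c *: \sum_(f < 7) \sum_(h < 7) P f h *: \sum_(a < 7) \sum_(b < 7) g f a b *:
    \sum_(d < 7) \sum_(e < 7) g h d e *: F a b d e.
Proof.
rewrite pair_bigA; under eq_bigr => r _.
  rewrite pair_bigA; under eq_bigr => s _ do rewrite pair_bigA.
  over.
rewrite (sum_bilinear c (fun p : 'I_7 * 'I_7 => P p.1 p.2)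
  (fun p r : 'I_7 * 'I_7 => g p.1 r.1 r.2) (fun p s : 'I_7 * 'I_7 => g p.2 s.1 s.2)
  (fun r s => F r.1 r.2 s.1 s.2)).
rewrite [in RHS]pair_bigA; congr (_ *: _); apply: eq_bigr => p _; congr (_ *: _).
rewrite [RHS]pair_bigA; apply: eq_bigr => r _; congr (_ *: _).
by rewrite pair_bigA.
Qed.

(** The product in [Upsilon] is bracketed to the left. As i <= j <= k, its first three letters form
    a sorted product, to which [bmul_lw] applies. *)
Lemma Upsilon_teval m (i j k l : 'I_m) : (i <= j)%N -> (j <= k)%N ->
  Upsilon gamma i j k l =
  @teval R m [:: i : nat; j : nat; k : nat; l : nat] upsilon_tensor (unitT m).
Proof.
move=> lij ljk; pose s := [:: i : nat; j : nat; k : nat; l : nat].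
pose F a b c d := lw s [:: a; b; c; d] (unitT m).
have XE a b c d : X i a ** X j b ** X k c ** X l d = F a b c d.
  have e1 : X i a ** X j b ** X k c = lw [:: i : nat; j : nat; k : nat] [:: a; b; c] (unitT m).
    apply: etrans (congr1 (fun x => x ** X k c) (@XX_lw R m i j a b)) _.
    apply: etrans (@bmul_lw2 R m i j [:: a; b] (X k c) (ltn_ord i) (ltn_ord j)) _.
    exact: (congr1 (@lw R m [:: i : nat; j : nat] [:: a; b]) (@X_lam R m k c)).
  have lts : all (fun r => (r < m)%N) [:: i : nat; j : nat; k : nat].
    by rewrite /= !ltn_ord.
  have srt : sorted leq [:: i : nat; j : nat; k : nat] by rewrite /= lij ljk.
  apply: etrans (congr1 (fun x => x ** X l d) e1) _.
  apply: etrans (@bmul_lw R m _ [:: a; b; c] (X l d) lts srt) _.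
  exact: (congr1 (@lw R m [:: i : nat; j : nat; k : nat] [:: a; b; c]) (@X_lam R m l d)).
have -> : Upsilon gamma i j k l =
    \sum_(a < 7) \sum_(b < 7) \sum_(c < 7) \sum_(d < 7)
      upsilon_coef gamma a b c d *: F a b c d.
  apply: eq_bigr => a _; apply: eq_bigr => b _; apply: eq_bigr => c _.
  by apply: eq_bigr => d _; rewrite XE.
rewrite (entry_sum_bilinear _ (phi R) (fun f => gamma (bvec R f)) F).
rewrite phi_tensorE.
rewrite (entry_sum_tensor _ (fun f h => \sum_(a < 7) \sum_(b < 7) gamma (bvec R f) a b *:
    \sum_(c < 7) \sum_(d < 7) gamma (bvec R h) c d *: F a b c d)).
pose g w := tcat (gamma_letter (nth p1 w 0)) (gamma_letter (nth p1 w 1)).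
have uE : upsilon_tensor = collect (tscale (qX 6) (tbind phi_tensor g)) by vm_compute.
have -> : teval s upsilon_tensor (unitT m) =
    q ^+ 6 *: tensor_ev phi_tensor (fun w => teval s (g w) (unitT m)).
  apply: etrans (congr1 (fun v => teval s v (unitT m)) uE) _.
  apply: etrans (teval_collect _ _ _) _; apply: etrans (teval_scale _ _ _ _) _.
  rewrite laurent_ev_qX; apply: (congr1 (fun x => q ^+ 6 *: x)).
  exact: tensor_ev_bind.
apply: (congr1 (fun x => q ^+ 6 *: x)); apply: eq_tensor_ev => w.
rewrite gamma_letterE (entry_sum_tensor _ (fun a b => \sum_(c < 7) \sum_(d < 7)
   gamma (bvec R (nth p1 w 1)) c d *: F a b c d)).
apply: etrans _ (esym (tensor_ev_tcat _ _ _)); apply: eq_tensor_ev => u.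
rewrite gamma_letterE (entry_sum_tensor _ (fun c d => F (nth p1 u 0) (nth p1 u 1) c d)).
by apply: eq_tensor_ev => v; rewrite /F !lw_cons !nth_behead.
Qed.

End Gamma.

End DimAndUpsilon.

(** * The relations *)

Section PhiRelations.
Variables (R : realType) (m : nat).
Local Notation K := (Cq R).
Local Notation q := (@qv R).
Local Notation unitT := (unitT R).
Local Opaque Phi bmul lam.

Lemma Phi_commute (i j k l : 'I_m) ks1 ks2 :
  let s1 := [:: i : nat; j : nat; k : nat; l : nat] in
  let s2 := [:: k : nat; l : nat; i : nat; j : nat] in
  swappable ks1 s1 -> swappable ks2 s2 -> swaps_seq ks1 s1 = swaps_seq ks2 s2 ->
  teq (swaps_tensor ks1 phi2_tensor) (swaps_tensor ks2 phi2_tensor) ->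
  Phi i j ** Phi k l = Phi k l ** Phi i j :> Tm R m.
Proof.
move=> s1 s2 ok1 ok2 es eqt.
apply: etrans (@Phi_Phi R m i j k l) _; apply: etrans _ (esym (@Phi_Phi R m k l i j)).
apply: etrans (@teval_swaps R m ks1 s1 phi2_tensor (unitT m) ok1) _.
apply: etrans _ (esym (@teval_swaps R m ks2 s2 phi2_tensor (unitT m) ok2)).
rewrite es; exact: teval_teq.
Qed.

Lemma Phi_commute_disjoint (i j k l : 'I_m) : (i <= j)%N -> (j < k)%N -> (k <= l)%N ->
  Phi i j ** Phi k l = Phi k l ** Phi i j :> Tm R m.
Proof.
move=> lij ljk lkl; have /andP[eqt _] := phi_commute_check.
have lik := leq_ltn_trans lij ljk; have ljl := leq_trans ljk lkl.
have lil := leq_trans lik lkl.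
apply: (@Phi_commute i j k l [::] [:: 1; 0; 2; 1]%N _ _ _ eqt).
- by [].
- by rewrite /= ljl lil ljk lik.
- by [].
Qed.

Lemma Phi_commute_nested (i j k l : 'I_m) : (k < i)%N -> (i < j)%N -> (j < l)%N ->
  Phi i j ** Phi k l = Phi k l ** Phi i j :> Tm R m.
Proof.
move=> lki lij ljl; have /andP[_ eqt] := phi_commute_check.
apply: (@Phi_commute i j k l [:: 1; 0]%N [:: 1; 2]%N _ _ _ eqt).
- by rewrite /= lki (ltn_trans lki lij).
- by rewrite /= ljl (ltn_trans lij ljl).
- by [].
Qed.

Lemma Phi_dim_relation (i j k l a b c d : 'I_m) t s ks1 ks2 ks3 :
  quad_member t (dim_relation ks1 ks2 ks3) ->
  let s1 := [:: i : nat; j : nat; k : nat; l : nat] in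
  let s2 := [:: k : nat; l : nat; i : nat; j : nat] in
  let s3 := [:: a : nat; b : nat; c : nat; d : nat] in
  [&& swappable ks1 s1, swappable ks2 s2 & swappable ks3 s3] ->
  [/\ swaps_seq ks1 s1 = s, swaps_seq ks2 s2 = s & swaps_seq ks3 s3 = s] ->
  (t.+1 < size s)%N -> nth 0%N s t = nth 0%N s t.+1 -> (nth 0%N s t < m)%N ->
  Phi i j ** Phi k l - q ^+ 2 *: (Phi k l ** Phi i j)
  =A ((1 - q ^+ 14) / dimqV *: (Phi a b ** Phi c d) : Tm R m).
Proof.
move=> mem s1 s2 s3 ok es ltt st ltm.
have e1 := @Phi_Phi R m i j k l; have e2 := @Phi_Phi R m k l i j.
have e3 := @Phi_Phi R m a b c d.
apply: eqA_null (f_equal2 (fun x y => x - q ^+ 2 *: y) e1 e2)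
  (congr1 (fun x => (1 - q ^+ 14) / dimqV *: x) e3) _.
exact: (dim_relation_null _ mem ok es ltt st ltm).
Qed.

Lemma Phi_swaps (i j k l : 'I_m) ks s :
  swappable ks [:: i : nat; j : nat; k : nat; l : nat] ->
  swaps_seq ks [:: i : nat; j : nat; k : nat; l : nat] = s ->
  Phi i j ** Phi k l = teval s (swaps_tensor ks phi2_tensor) (unitT m).
Proof.
move=> ok <-; apply: etrans (@Phi_Phi R m i j k l) _; exact: teval_swaps.
Qed.

Lemma upsilon_relation_eval s (z : Tm R m) :
  let v ks := teval s (swaps_tensor ks phi2_tensor) z in
  q^-1 *: v [:: 1; 0; 2]%N - q *: v [:: 1]%N =
  (q - q^-1) *: (v [:: 1; 2]%N - (q ^+ 2 + q ^- 2) *: v [::] + teval s upsilon_tensor z).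
Proof.
move=> v.
have l1 : laurent_ev R (qX (-1)) = q^-1 by rewrite laurent_ev_qX -exprN1.
have l2 : laurent_ev R (qXN 1) = - q by rewrite laurent_ev_qXN; exact: (congr1 _ (expr1z q)).
have l3 : laurent_ev R [:: (1, 1); (-1, -1)]%Z = q - q^-1.
  rewrite /laurent_ev big_cons big_seq1 mono_ev_pos mono_ev_neg -exprN1.
  exact: (congr1 (fun x => x - _) (expr1z q)).
have l4 : laurent_ev R [:: (2, -1); (-2, -1)]%Z = - (q ^+ 2 + q ^- 2).
  by rewrite /laurent_ev big_cons big_seq1 !mono_ev_neg opprD.
have split_eval a b c d u :
    teq (tscale (qX (-1)) a ++ tscale (qXN 1) b)
      (tscale [:: (1, 1); (-1, -1)]%Z (c ++ tscale [:: (2, -1); (-2, -1)]%Z d ++ u)) ->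
    q^-1 *: teval s a z - q *: teval s b z =
    (q - q^-1) *: (teval s c z - (q ^+ 2 + q ^- 2) *: teval s d z + teval s u z).
  move=> /(teval_teq s z); rewrite teval_cat !teval_scale teval_cat teval_cat teval_scale.
  by rewrite l1 l2 l3 l4 addrA !scaleNr.
exact: split_eval upsilon_relation_check.
Qed.

Lemma eqA_eq (x y : Tm R m) : x = y -> x =A y.
Proof. by move->; apply: null_Am_ker; rewrite subrr; apply: null_0. Qed.

Lemma eqA0 (x y : Tm R m) : x = y -> x - y =A 0.
Proof. by move->; apply: null_Am_ker; rewrite subr0 subrr; apply: null_0. Qed.

End PhiRelations.

(* In the second and third relations k lies outside the interval [i, j]. For
   i < k < j the same two invariants are related by another instance of these
   relations (exchange j and k in the second one, i and k in the third one). *)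
Theorem lemma5p11 (R : realType) (m : nat)
    (gamma : 'Hom('rV[Cq R]_7, 'M[Cq R]_7))
    (gamma_Uq : is_Uqmap gamma) (gamma1 : gamma (bvec R p1) = gamma_v1) :
  let q : Cq R := qv in
  [/\ (forall i j k : 'I_m,
         Phi i i ** Phi j k - Phi j k ** Phi i i =A (0 : Tm R m)),
      (forall i j k : 'I_m, (i < j)%N -> ~~ (i <= k <= j)%N ->
         Phi i k ** Phi i j - q ^+ 2 *: (Phi i j ** Phi i k)
         =A (1 - q ^+ 14) / dimqV *: (Phi i i ** Phi j k)),
      (forall i j k : 'I_m, (i < j)%N -> ~~ (i <= k <= j)%N ->
         Phi i j ** Phi j k - q ^+ 2 *: (Phi j k ** Phi i j)
         =A (1 - q ^+ 14) / dimqV *: (Phi j j ** Phi i k)),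
      (forall i j k l : 'I_m, (i <= j)%N -> (k <= l)%N ->
         [|| (j < k)%N, [&& (k < i)%N, (i < j)%N & (j < l)%N] | (l < i)%N] ->
         Phi i j ** Phi k l - Phi k l ** Phi i j =A (0 : Tm R m))
    & (forall i j k l : 'I_m, (i < k)%N -> (k < j)%N -> (j < l)%N ->
         q^-1 *: (Phi k l ** Phi i j) - q *: (Phi i j ** Phi k l)
         =A (q - q^-1) *: (Phi i l ** Phi k j
              - (q ^+ 2 + q ^- 2) *: (Phi i k ** Phi j l)
              + Upsilon gamma i k j l))].
Proof.
move=> q; split.
- move=> i j k; apply: (eqA_null erefl erefl).
  have := Phi_diag_central R i j k.
  by rewrite -[X in null X]subr0.
- move=> i j k ltij; rewrite negb_and -!ltnNge => /orP[ltki|ltjk].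
    have ok : [&& swappable [:: 0]%N [:: i : nat; k : nat; i : nat; j : nat],
      swappable [:: 2; 1; 0; 2]%N [:: i : nat; j : nat; i : nat; k : nat] &
        swappable [:: 2; 1; 0]%N [:: i : nat; i : nat; j : nat; k : nat]].
      by rewrite /= ltki ltij (ltn_trans ltki ltij).
    have /and4P[_ dim _ _] := dim_relation_check.
    have rel := @Phi_dim_relation R m i k i j i i j k 1%N
      [:: k : nat; i : nat; i : nat; j : nat]
      [:: 0]%N [:: 2; 1; 0; 2]%N [:: 2; 1; 0]%N dim ok.
    exact: rel (And3 erefl erefl erefl) isT erefl (ltn_ord _).
  have ok : [&& swappable [:: 1; 2]%N [:: i : nat; k : nat; i : nat; j : nat],
      swappable [:: 1]%N [:: i : nat; j : nat; i : nat; k : nat] &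
      swappable [::] [:: i : nat; i : nat; j : nat; k : nat]].
    by rewrite /= ltij ltjk (ltn_trans ltij ltjk).
  have /and4P[dim _ _ _] := dim_relation_check.
  have rel := @Phi_dim_relation R m i k i j i i j k 0%N [:: i : nat; i : nat; j : nat; k : nat]
      [:: 1; 2]%N [:: 1]%N [::] dim ok.
  exact: rel (And3 erefl erefl erefl) isT erefl (ltn_ord _).
- move=> i j k ltij; rewrite negb_and -!ltnNge => /orP[ltki|ltjk].
    have ok : [&& swappable [:: 2; 1; 0]%N [:: i : nat; j : nat; j : nat; k : nat],
      swappable [:: 0; 1]%N [:: j : nat; k : nat; i : nat; j : nat] &
        swappable [:: 2; 1; 0; 2; 1]%N [:: j : nat; j : nat; i : nat; k : nat]].
      by rewrite /= ltki ltij (ltn_trans ltki ltij).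
    have /and4P[_ _ _ dim] := dim_relation_check.
    have rel := @Phi_dim_relation R m i j j k j j i k 2%N
      [:: k : nat; i : nat; j : nat; j : nat]
      [:: 2; 1; 0]%N [:: 0; 1]%N [:: 2; 1; 0; 2; 1]%N dim ok.
    exact: rel (And3 erefl erefl erefl) isT erefl (ltn_ord _).
  have ok : [&& swappable [::] [:: i : nat; j : nat; j : nat; k : nat],
      swappable [:: 1; 0; 2]%N [:: j : nat; k : nat; i : nat; j : nat] &
      swappable [:: 1; 0]%N [:: j : nat; j : nat; i : nat; k : nat]].
    by rewrite /= ltij ltjk (ltn_trans ltij ltjk).
  have /and4P[_ _ dim _] := dim_relation_check.
  have rel := @Phi_dim_relation R m i j j k j j i k 1%N [:: i : nat; j : nat; j : nat; k : nat]
      [::] [:: 1; 0; 2]%N [:: 1; 0]%N dim ok.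
  exact: rel (And3 erefl erefl erefl) isT erefl (ltn_ord _).
- move=> i j k l lij lkl /or3P[ltjk|/and3P[ltki ltij ltjl]|ltli]; apply: eqA0.
  + exact: Phi_commute_disjoint.
  + exact: Phi_commute_nested.
  + exact/esym/Phi_commute_disjoint.
- move=> i j k l ltik ltkj ltjl; apply: eqA_eq.
  have ltij := ltn_trans ltik ltkj; have ltkl := ltn_trans ltkj ltjl.
  have ltil := ltn_trans ltik ltkl; pose s := [:: i : nat; k : nat; j : nat; l : nat].
  have e1 : Phi k l ** Phi i j = teval s (swaps_tensor [:: 1; 0; 2]%N phi2_tensor) (unitT R m).
    by apply: Phi_swaps; rewrite /= ?ltil ?ltik ?ltjl.
  have e2 : Phi i j ** Phi k l = teval s (swaps_tensor [:: 1]%N phi2_tensor) (unitT R m).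
    by apply: Phi_swaps; rewrite /= ?ltkj.
  have e3 : Phi i l ** Phi k j = teval s (swaps_tensor [:: 1; 2]%N phi2_tensor) (unitT R m).
    by apply: Phi_swaps; rewrite /= ?ltkl ?ltjl.
  have e4 : Phi i k ** Phi j l = teval s (swaps_tensor [::] phi2_tensor) (unitT R m).
    exact: Phi_swaps.
  have e5 := Upsilon_teval gamma_Uq gamma1 l (ltnW ltik) (ltnW ltkj).
  apply: etrans (f_equal2 (fun x y => q^-1 *: x - q *: y) e1 e2) _.
  apply: etrans (upsilon_relation_eval _ _) _; apply: (congr1 (fun x => (q - q^-1) *: x)).
  apply: esym; apply: f_equal2 e5.
  exact: (f_equal2 (fun x y => x - (q ^+ 2 + q ^- 2) *: y) e3 e4).
Qed.
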